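(* Let $f:(\mathbb K^n,0)\to(\mathbb K^p,0)$ be a $\mathcal K_e$-finite weighted-homogeneous analytic map-germ with good weights (with respect to the chosen $\bar f^1,\dots,\bar f^m$ below). Then every stable unfolding of $f$ of the form $$F(x,\lambda)=\Big(f(x)+\sum_{k=1}^m\Big(\lambda_k+\sum_{s=1}^m\lambda_s\,q_k^s(f(x),\lambda)\Big)\bar f^k(x),\ \lambda\Big),\qquad q_k^s\in\mathcal O_{p+m},\ q_k^s(X,0)\in\mathfrak m_p,$$ is substantial.
   Context: Let $\mathbb K=\mathbb C$ or $\mathbb R$; all germs analytic. $\mathcal O_s$ is the ring of germs of functions on $(\mathbb K^s,0)$, $\mathfrak m_s$ its maximal ideal, $\theta_s$ the module of germs of vector fields; $\theta(f)\cong\mathcal O_n^p$, with basis $\partial/\partial X_j$. $T\mathcal K_e f=df(\theta_n)+f^*\mathfrak m_p\theta(f)$; $f$ is $\mathcal K_e$-finite if this has finite $\mathbb K$-codimension in $\theta(f)$. A germ $g$ is stable if $dg(\theta_n)+\{\eta\circ g:\eta\in\theta_p\}$ is all of $\theta(g)$. $\bar f^1,\dots,\bar f^m\in\theta(f)$ are chosen so that $T\mathcal K_e f+\mathrm{span}_{\mathbb K}\{\bar f^k\}+\mathrm{span}_{\mathbb K}\{\partial/\partial X_j\}=\theta(f)$ with $m$ minimal, and each $\bar f^k=x^{\alpha_k}\partial/\partial X_{j_k}$ is a single monomial in the single component $j_k$. $f=(f_1,\dots,f_p)$ is weighted-homogeneous if there are positive integers $w_1,\dots,w_n,d_1,\dots,d_p$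 with $f_j(t^{w_1}x_1,\dots,t^{w_n}x_n)=t^{d_j}f_j(x)$ for all $j$ and $t\in\mathbb K$. Then each monomial $x^{\alpha_k}$ has a weighted degree $d_{p+k}=\sum_i w_i(\alpha_k)_i$; $f$ has good weights if $d_{p+k}\neq d_{j_k}$ for all $k=1,\dots,m$. An $m$-parameter unfolding of $f$ is $F(x,\lambda)=(f_\lambda(x),\lambda)$ with $f_0=f$; target coordinates $(X,\Lambda)\in\mathbb K^p\times\mathbb K^m$; $\mathfrak m_\Lambda\subset\mathcal O_{p+m}$ is the ideal generated by $\Lambda_1,\dots,\Lambda_m$. $\eta\in\theta_{p+m}$ is liftable for $F$ if $\eta\circ F=dF(\xi)$ for some $\xi\in\theta_{n+m}$. A stable unfolding $F$ is substantial if there is a liftable $\eta=(\eta_1,\dots,\eta_{p+m})$ with $\eta_{p+k}=\Lambda_k u_k+q_k$, $u_k$ a unit of $\mathcal O_{p+m}$, $q_k\in\mathfrak m_\Lambda\mathfrak m_{p+m}$, for all $k=1,\dots,m$. *)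

(* Defs.v *)
From mathcomp Require Import all_boot all_order all_algebra.
From mathcomp Require Import all_classical all_reals all_analysis.
From mathcomp Require Export complex.
Import numFieldNormedType.Exports.
Set Implicit Arguments. Unset Strict Implicit. Unset Printing Implicit Defensive.
Import Order.TTheory GRing.Theory Num.Theory.
Local Open Scope classical_set_scope.
Local Open Scope ring_scope.

(* Germs at 0 of functions K^s -> K.  A point of K^s is a row vector        *)
(* 'rV[K]_s.  A germ is represented by any function ('rV[K]_s -> K); two    *)
(* functions define the same germ iff they agree on a neighbourhood of 0.   *)

Section Germs.
Variable K : numFieldType.

Definition monom (s : nat) (a : 'I_s -> nat) (x : 'rV[K]_s) : K :=
  \prod_(i < s) x ord0 i ^+ a i.

Definition mdeg (s : nat) (a : 'I_s -> nat) : nat := (\sum_(i < s) a i)%N.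

Definition psum (s : nat) (c : ('I_s -> nat) -> K) (x : 'rV[K]_s) (N : nat) : K :=
  \sum_(a : {ffun 'I_s -> 'I_N.+1} | (mdeg (fun i => nat_of_ord (a i)) <= N)%N)
     c (fun i => nat_of_ord (a i)) * monom (fun i => nat_of_ord (a i)) x.

Definition germ_eq (s : nat) (g h : 'rV[K]_s -> K) : Prop :=
  \forall x \near (0 : 'rV[K]_s), g x = h x.

Definition analytic0 (s : nat) (g : 'rV[K]_s -> K) : Prop :=
  exists c : ('I_s -> nat) -> K,
    (exists r : K, exists M : K, 0 < r /\
       forall a, `|c a| * r ^+ mdeg a <= M) /\
    \forall x \near (0 : 'rV[K]_s), cvg_to (psum c x @ \oo) (nbhs (g x)).

Definition pderiv (s : nat) (g : 'rV[K]_s -> K) (i : 'I_s) (x : 'rV[K]_s) : K :=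
  'D_(delta_mx ord0 i) g x.

Definition comp (s t : nat) (G : 'rV[K]_s -> 'rV[K]_t) (j : 'I_t) : 'rV[K]_s -> K :=
  fun x => G x ord0 j.

Definition dmap (s t : nat) (G : 'rV[K]_s -> 'rV[K]_t)
    (xi : 'I_s -> 'rV[K]_s -> K) (j : 'I_t) : 'rV[K]_s -> K :=
  fun x => \sum_(i < s) xi i x * pderiv (comp G j) i x.

Definition vfield (s t : nat) (v : 'I_t -> 'rV[K]_s -> K) : Prop :=
  forall j, analytic0 (v j).

Definition vf_eq (s t : nat) (v w : 'I_t -> 'rV[K]_s -> K) : Prop :=
  forall j, germ_eq (v j) (w j).

Definition in_TKe (n p : nat) (f : 'rV[K]_n -> 'rV[K]_p)
    (v : 'I_p -> 'rV[K]_n -> K) : Prop :=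
  exists (xi : 'I_n -> 'rV[K]_n -> K) (a : 'I_p -> 'I_p -> 'rV[K]_n -> K),
    vfield xi /\ (forall l, vfield (a l)) /\
    vf_eq v (fun j x => dmap f xi j x + \sum_(l < p) comp f l x * a l j x).

Definition TKe_span (n p N : nat) (f : 'rV[K]_n -> 'rV[K]_p)
    (g : 'I_N -> 'I_p -> 'rV[K]_n -> K) : Prop :=
  forall w : 'I_p -> 'rV[K]_n -> K, vfield w ->
    exists (v : 'I_p -> 'rV[K]_n -> K) (b : 'I_N -> K),
      in_TKe f v /\ vf_eq w (fun j x => v j x + \sum_(k < N) b k * g k j x).

Definition Ke_finite (n p : nat) (f : 'rV[K]_n -> 'rV[K]_p) : Prop :=
  exists N (g : 'I_N -> 'I_p -> 'rV[K]_n -> K),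
    (forall k, vfield (g k)) /\ TKe_span f g.

Definition TKe_span_X (n p m : nat) (f : 'rV[K]_n -> 'rV[K]_p)
    (g : 'I_m -> 'I_p -> 'rV[K]_n -> K) : Prop :=
  forall w : 'I_p -> 'rV[K]_n -> K, vfield w ->
    exists (v : 'I_p -> 'rV[K]_n -> K) (b : 'I_m -> K) (c : 'I_p -> K),
      in_TKe f v /\
      vf_eq w (fun j x => v j x + \sum_(k < m) b k * g k j x + c j).

Definition fbar (n p m : nat) (alpha : 'I_m -> 'I_n -> nat) (jk : 'I_m -> 'I_p)
    (k : 'I_m) (j : 'I_p) : 'rV[K]_n -> K :=
  fun x => if j == jk k then monom (alpha k) x else 0.

Definition good_choice (n p m : nat) (f : 'rV[K]_n -> 'rV[K]_p)
    (alpha : 'I_m -> 'I_n -> nat) (jk : 'I_m -> 'I_p) : Prop :=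
  TKe_span_X f (fbar alpha jk) /\
  forall m' (g : 'I_m' -> 'I_p -> 'rV[K]_n -> K),
    (forall k, vfield (g k)) -> TKe_span_X f g -> (m <= m')%N.

Definition wscale (n : nat) (w : 'I_n -> nat) (t : K) (x : 'rV[K]_n) : 'rV[K]_n :=
  \row_(i < n) (t ^+ w i * x ord0 i).

Definition weighted_homogeneous (n p : nat) (f : 'rV[K]_n -> 'rV[K]_p)
    (w : 'I_n -> nat) (d : 'I_p -> nat) : Prop :=
  (forall i, (0 < w i)%N) /\ (forall j, (0 < d j)%N) /\
  forall (t : K) (j : 'I_p),
    germ_eq (fun x => comp f j (wscale w t x)) (fun x => t ^+ d j * comp f j x).

Definition good_weights (n p m : nat) (w : 'I_n -> nat) (d : 'I_p -> nat)
    (alpha : 'I_m -> 'I_n -> nat) (jk : 'I_m -> 'I_p) : Prop :=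
  forall k : 'I_m, (\sum_(i < n) w i * alpha k i)%N <> d (jk k).

Definition stable (s t : nat) (G : 'rV[K]_s -> 'rV[K]_t) : Prop :=
  forall zeta : 'I_t -> 'rV[K]_s -> K, vfield zeta ->
    exists (xi : 'I_s -> 'rV[K]_s -> K) (eta : 'I_t -> 'rV[K]_t -> K),
      vfield xi /\ vfield eta /\
      vf_eq zeta (fun j x => dmap G xi j x + eta j (G x)).

Definition liftable (s t : nat) (G : 'rV[K]_s -> 'rV[K]_t)
    (eta : 'I_t -> 'rV[K]_t -> K) : Prop :=
  vfield eta /\
  exists xi : 'I_s -> 'rV[K]_s -> K,
    vfield xi /\ vf_eq (fun j x => eta j (G x)) (dmap G xi).

Definition Lam (p m : nat) (k : 'I_m) (Y : 'rV[K]_(p + m)) : K :=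
  Y ord0 (rshift p k).

(* substantial (the stability of F is a separate hypothesis):               *)
(* there is a liftable eta with eta_{p+k} = Lambda_k u_k + q_k, u_k a unit of  *)
(* O_{p+m} and q_k in m_Lambda m_{p+m}, i.e. q_k = sum_l Lambda_l a_{kl} with *)
(* a_{kl} in m_{p+m}.                                                        *)
Definition substantial (n p m : nat) (F : 'rV[K]_(n + m) -> 'rV[K]_(p + m)) : Prop :=
  exists eta : 'I_(p + m) -> 'rV[K]_(p + m) -> K,
    liftable F eta /\
    forall k : 'I_m,
      exists (u : 'rV[K]_(p + m) -> K) (a : 'I_m -> 'rV[K]_(p + m) -> K),
        analytic0 u /\ u 0 != 0 /\
        (forall l, analytic0 (a l) /\ a l 0 = 0) /\
        germ_eq (eta (rshift p k))
          (fun Y => Lam k Y * u Y + \sum_(l < m) Lam l Y * a l Y).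

Definition unfoldingF (n p m : nat) (f : 'rV[K]_n -> 'rV[K]_p)
    (alpha : 'I_m -> 'I_n -> nat) (jk : 'I_m -> 'I_p)
    (q : 'I_m -> 'I_m -> 'rV[K]_(p + m) -> K)
    (z : 'rV[K]_(n + m)) : 'rV[K]_(p + m) :=
  let x := lsubmx z in
  let lam := rsubmx z in
  row_mx
    (f x + \sum_(k < m)
        (lam ord0 k + \sum_(s < m) lam ord0 s * q k s (row_mx (f x) lam))
          *: (\row_(j < p) fbar alpha jk k j x))
    lam.

Definition Theorem5 : Prop :=
  forall (n p m : nat) (f : 'rV[K]_n -> 'rV[K]_p)
         (w : 'I_n -> nat) (d : 'I_p -> nat)
         (alpha : 'I_m -> 'I_n -> nat) (jk : 'I_m -> 'I_p),
    (forall j, analytic0 (comp f j)) ->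
    f 0 = 0 ->
    Ke_finite f ->
    good_choice f alpha jk ->
    weighted_homogeneous f w d ->
    good_weights w d alpha jk ->
    forall q : 'I_m -> 'I_m -> 'rV[K]_(p + m) -> K,
      (forall k s, analytic0 (q k s)) ->
      (forall k s, q k s 0 = 0) ->
      stable (unfoldingF f alpha jk q) ->
      substantial (unfoldingF f alpha jk q).

End Germs.

(* Main.v *)
From HB Require Import structures.
Require Import Defs.
From mathcomp Require Import all_boot all_order all_algebra finmap.
From mathcomp Require Import all_classical all_reals all_analysis.
From mathcomp Require Import complex ring.
Import numFieldNormedType.Exports.
Set Implicit Arguments.
Unset Strict Implicit.
Unset Printing Implicit Defensive.
Import Order.TTheory GRing.Theory Num.Theory.
Local Open Scope classical_set_scope.
Local Open Scope ring_scope.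

(** Put [e_k = d_{j_k} - d_{p+k}]. For [q = 0] the Euler field
    [sum_i w_i x_i d/dx_i + sum_k e_k lambda_k d/dlambda_k] lifts
    [sum_j d_j X_j d/dX_j + sum_k e_k Lambda_k d/dLambda_k]. In general the
    lifting equation fails by [sum_s lambda_s sum_k H_ks(f(x), lambda) fbar^k]
    with [H_ks(0) = 0]. Replacing [(f(x), lambda)] by [F(x, lambda)] in [H_ks]
    costs only terms quadratic in [lambda], and stability of [F] writes every
    [fbar^k], and every vector field that is multiplied by a quadratic term, as
    [dF(xi) + eta o F]. Subtracting these lifts corrects the [Lambda]-components
    of the target field by elements of [m_Lambda m_{p+m}] only, and the [e_k]
    are nonzero because the weights are good.

    Germs are handled through absolutely convergent unordered sums of monomials
    on polydiscs; the calculus of germs (chain rule, analyticity of partial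
    derivatives) is deduced from Hadamard's lemma, applied to [g(x + y)]. *)

(** * Unordered summation *)

Section Summation.
Variable K : numFieldType.

(** The shape of the correction is dictated by which multiplications are allowed. If
    [zeta = dF(xi) + eta o F], then [(h o F) zeta] has the same form, with [(h o F) xi] and [h eta];
    multiplying by a function of the source destroys it. The defect arises as [H o g] with
    [g(x, lambda) = (f(x), lambda)], hence the need to pass to [H o F]. The remainder carries
    factors [lambda_s lambda_r], which are pulled back by [F] since [lambda = Lambda o F], and a
    coefficient that is a genuine function of the source. That coefficient stays inside the vector
    field to which stability is applied, and only the factors [lambda] are taken out. Over the real
    and the complex numbers the argument is the same, so the field stays abstract and completeness
    enters as one hypothesis. In a [numFieldType], [0 < e] already forces [e] to be real, so the
    epsilon definitions below make sense although the order of [K] may be partial. *)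

Definition hasSum (I : choiceType) (f : I -> K) (l : K) : Prop :=
  forall e : K, 0 < e -> exists A : {fset I}, forall B : {fset I},
    (A `<=` B)%fset -> `|l - \sum_(i <- B) f i| <= e.

Definition absBounded (I : choiceType) (f : I -> K) (M : K) : Prop :=
  forall A : {fset I}, \sum_(i <- A) `|f i| <= M.

(** Completeness phrased without suprema or Cauchy sequences, so that it makes sense for a partially
    ordered [K]. It also yields the Archimedean property, see [expr_half_small]. *)
Definition summationComplete : Prop :=
  forall (I : choiceType) (f : I -> K) (M : K),
    absBounded f M -> exists l, hasSum f l.

Lemma ler_sum_fsub (I : choiceType) (A B : {fset I}) (f : I -> K) :
  (forall i, 0 <= f i) -> (A `<=` B)%fset ->
  \sum_(i <- A) f i <= \sum_(i <- B) f i.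
Proof.
move=> f0 AB; rewrite [leRHS](big_fsetID _ (mem A)) /=.
have -> : [fset x in B | x \in A]%fset = A.
  apply/fsetP => x; rewrite !inE /=; apply/andP/idP => [[]//|xA].
  by split => //; exact: (fsubsetP AB).
by rewrite lerDl; apply: sumr_ge0.
Qed.

Lemma absBounded_ge0 (I : choiceType) (f : I -> K) (M : K) :
  absBounded f M -> 0 <= M.
Proof. by move=> /(_ fset0); rewrite big_seq_fset0. Qed.

Lemma eq_hasSum (I : choiceType) (f g : I -> K) (l : K) :
  f =1 g -> hasSum f l -> hasSum g l.
Proof.
move=> fg Hf e e0; have [A HA] := Hf e e0; exists A => B AB.
by under eq_bigr do rewrite -fg; exact: HA.
Qed.

Lemma hasSum_unique (I : choiceType) (f : I -> K) (l1 l2 : K) :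
  hasSum f l1 -> hasSum f l2 -> l1 = l2.
Proof.
move=> H1 H2; apply/eqP; rewrite -subr_eq0 -normr_le0; apply/ler_addgt0Pl => e e0.
have e2 : 0 < e / 2 by rewrite divr_gt0.
have [A HA] := H1 _ e2; have [B HB] := H2 _ e2.
have := HA _ (fsubsetUl A B); have := HB _ (fsubsetUr A B).
set s := \sum_(i <- _) _ => h2 h1.
have -> : l1 - l2 = (l1 - s) - (l2 - s) by rewrite opprB addrA subrK.
by rewrite addr0 [e]splitr (le_trans (ler_normB _ _)) // lerD.
Qed.

Lemma hasSum0 (I : choiceType) : hasSum (fun _ : I => 0) 0.
Proof. by move=> e e0; exists fset0 => B _; rewrite big1 // subrr normr0 ltW. Qed.

Lemma hasSumD (I : choiceType) (f g : I -> K) (l1 l2 : K) :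
  hasSum f l1 -> hasSum g l2 -> hasSum (fun i => f i + g i) (l1 + l2).
Proof.
move=> H1 H2 e e0.
have e2 : 0 < e / 2 by rewrite divr_gt0.
have [A HA] := H1 _ e2; have [B HB] := H2 _ e2.
exists (A `|` B)%fset => C; rewrite fsubUset => /andP[AC BC].
rewrite big_split /= opprD addrACA [e]splitr.
by rewrite (le_trans (ler_normD _ _)) // lerD ?HA ?HB.
Qed.

Lemma hasSumZ (I : choiceType) (f : I -> K) (c l : K) :
  hasSum f l -> hasSum (fun i => c * f i) (c * l).
Proof.
move=> H e e0.
have c1 : 0 < `|c| + 1 by rewrite ltr_wpDl.
have [A HA] := H (e / (`|c| + 1)) (divr_gt0 e0 c1).
exists A => B AB; rewrite -mulr_sumr -mulrBr normrM.
apply: (@le_trans _ _ ((`|c| + 1) * (e / (`|c| + 1)))).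
  by rewrite ler_pM ?HA // lerDl.
by rewrite mulrC divfK // gt_eqF.
Qed.

Lemma hasSum_bigsum (I J : choiceType) (s : seq I) (f : I -> J -> K) (g : I -> K) :
  (forall i, hasSum (f i) (g i)) ->
  hasSum (fun j => \sum_(i <- s) f i j) (\sum_(i <- s) g i).
Proof.
move=> H; elim: s => [|i s IH].
  by rewrite big_nil; apply: eq_hasSum (@hasSum0 J) => j; rewrite big_nil.
by rewrite big_cons; apply: eq_hasSum (hasSumD (H i) IH) => j; rewrite big_cons.
Qed.

Lemma hasSum_norm_le (I : choiceType) (f : I -> K) (l M : K) :
  absBounded f M -> hasSum f l -> `|l| <= M.
Proof.
move=> bf H; apply/ler_addgt0Pr => e e0; have [A HA] := H e e0.
rewrite -(subrK (\sum_(i <- A) f i) l) addrC (le_trans (ler_normD _ _)) //.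
by rewrite lerD ?HA // (le_trans _ (bf A)) // ler_norm_sum.
Qed.

Lemma absBoundedW (I : choiceType) (f g : I -> K) (M : K) :
  (forall i, `|f i| <= `|g i|) -> absBounded g M -> absBounded f M.
Proof. by move=> fg bg A; apply: le_trans (bg A); apply: ler_sum. Qed.

Lemma absBoundedZ (I : choiceType) (f : I -> K) (c M : K) :
  absBounded f M -> absBounded (fun i => c * f i) (`|c| * M).
Proof.
move=> bf A; under eq_bigr do rewrite normrM.
by rewrite -mulr_sumr ler_wpM2l.
Qed.

Lemma sum_fsetM (I J : choiceType) (A : {fset I}) (B : {fset J})
    (f : I * J -> K) :
  \sum_(p <- (A `*` B)%fset) f p = \sum_(i <- A) \sum_(j <- B) f (i, j).
Proof.
rewrite -big_allpairs; apply: perm_big; apply: uniq_perm.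
- exact: fset_uniq.
- by apply: allpairs_uniq; [exact: fset_uniq..|move=> [? ?] [? ?]].
- move=> [i j]; rewrite inE /=; apply/andP/allpairsP => /= [[iA jB]|].
    by exists (i, j).
  by case=> -[x y] /= [xA yB [-> ->]].
Qed.

Lemma fsub_fsetM (I J : choiceType) (A : {fset I * J}) :
  (A `<=` [fset p.1 | p in A] `*` [fset p.2 | p in A])%fset.
Proof.
by apply/fsubsetP => p pA; rewrite inE; apply/andP; split; apply/imfsetP; exists p.
Qed.

Lemma absBounded_pair (I J : choiceType) (f : I * J -> K) (m : I -> K) (M : K) :
  (forall i, absBounded (fun j => f (i, j)) (m i)) ->
  absBounded m M -> absBounded f M.
Proof.
move=> bf bm A; apply: le_trans (ler_sum_fsub _ (fsub_fsetM A)) _ => //.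
rewrite sum_fsetM; apply: le_trans (bm [fset p.1 | p in A]%fset).
by apply: ler_sum => i _; rewrite (le_trans (bf i _)) // ger0_norm // (absBounded_ge0 (bf i)).
Qed.

Lemma hasSum_fubini (I J : choiceType) (f : I * J -> K) (g : I -> K) (l : K) :
  hasSum f l -> (forall i, hasSum (fun j => f (i, j)) (g i)) -> hasSum g l.
Proof.
move=> Hf Hg e e0; have e2 : 0 < e / 2 by rewrite divr_gt0.
have [A HA] := Hf _ e2.
exists [fset p.1 | p in A]%fset => B AB.
have [C HC] := hasSum_bigsum B Hg e2.
(* [D] serves two purposes: it is large enough for all rows in [B] at once, and [B * D] contains
   [A]. *)
pose D := (C `|` [fset p.2 | p in A])%fset.
have HD := HC D (fsubsetUl _ _).
have /HA : (A `<=` B `*` D)%fset.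
  apply/fsubsetP => p pA; have := fsubsetP (fsub_fsetM A) _ pA.
  rewrite !inE => /andP[p1 p2]; rewrite (fsubsetP AB) //=.
  by rewrite p2 orbT.
rewrite sum_fsetM exchange_big /= => HBD.
rewrite [e]splitr (le_trans (ler_distD (\sum_(j <- D) \sum_(i <- B) f (i, j)) _ _)) //.
by rewrite lerD // distrC.
Qed.

(** Reindexing along an injection, with zero outside its image. The use is shifting exponents:
    multiplication by a monomial reaches only the multi-indices above a given one. *)
Lemma hasSum_pinj (I J : choiceType) (h : J -> I) (h' : I -> option J)
    (f : J -> K) (l : K) :
  pcancel h h' -> ocancel h' h ->
  hasSum f l -> hasSum (fun i => oapp f 0 (h' i)) l.
Proof.
move=> hK h'K Hf e e0; have [A HA] := Hf e e0.
exists (h @` A)%fset => B AB.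
have -> : \sum_(i <- B) oapp f 0 (h' i) = \sum_(j <- pmap h' B) f j.
  elim: (enum_fset B) => [|i s IH]; first by rewrite !big_nil.
  by rewrite big_cons /= IH; case: (h' i) => [j|] /=; rewrite ?add0r // big_cons.
have u : uniq (pmap h' B) by apply: pmap_uniq h'K _ (fset_uniq B).
have := HA [fset j in pmap h' B]%fset.
rewrite (perm_big (pmap h' B)) /=; last first.
  by apply: uniq_perm; [exact: fset_uniq|exact: u|move=> j; rewrite !inE].
apply; apply/fsubsetP => j jA; rewrite !inE /=.
rewrite mem_pmap; apply/mapP; exists (h j); last by rewrite hK.
by apply: (fsubsetP AB); apply/imfsetP; exists j.
Qed.

Lemma absBounded_pinj (I J : choiceType) (h : J -> I) (h' : I -> option J)
    (f : J -> K) (M : K) :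
  ocancel h' h -> absBounded f M -> absBounded (fun i => oapp f 0 (h' i)) M.
Proof.
move=> h'K bf B.
have -> : \sum_(i <- B) `|oapp f 0 (h' i)| = \sum_(j <- pmap h' B) `|f j|.
  elim: (enum_fset B) => [|i s IH]; first by rewrite !big_nil.
  by rewrite big_cons /= IH; case: (h' i) => [j|] /=; rewrite ?normr0 ?add0r // big_cons.
have u : uniq (pmap h' B) by apply: pmap_uniq h'K _ (fset_uniq B).
have := bf [fset j in pmap h' B]%fset.
rewrite (perm_big (pmap h' B)) //=.
by apply: uniq_perm; [exact: fset_uniq|exact: u|move=> j; rewrite !inE].
Qed.

(** Finitely many rows can be truncated to a common finite set of columns with total error [e]; what
    remains is a sum over a finite rectangle. *)
Lemma absBounded_rows (I J : choiceType) (F : I * J -> K) (g : I -> K) (M : K) :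
  absBounded F M -> (forall i, hasSum (fun j => F (i, j)) (g i)) -> absBounded g M.
Proof.
move=> bF Hg A.
have approx (s : seq I) : forall e : K, 0 < e -> exists B : {fset J},
    forall C, (B `<=` C)%fset ->
    \sum_(i <- s) `|g i| <= \sum_(i <- s) `|\sum_(j <- C) F (i, j)| + e.
  elim: s => [|i s IH] e e0.
    by exists fset0 => C _; rewrite !big_nil add0r ltW.
  have e2 : 0 < e / 2 by rewrite divr_gt0.
  have [B HB] := IH _ e2; have [B' HB'] := Hg i _ e2.
  exists (B `|` B')%fset => C; rewrite fsubUset => /andP[/HB h1 /HB' h2].
  rewrite !big_cons [e]splitr addrACA lerD //.
  rewrite -lerBlDl; apply: le_trans h2; exact: lerB_dist.
apply/ler_addgt0Pr => e e0; have [B HB] := approx A e e0.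
apply: le_trans (HB _ (fsubset_refl B)) _; rewrite lerD2r.
apply: le_trans (bF (A `*` B)%fset); rewrite sum_fsetM.
by apply: ler_sum => i _; exact: ler_norm_sum.
Qed.

Lemma hasSum_swap (I J : choiceType) (f : I * J -> K) (l : K) :
  hasSum f l -> hasSum (fun p : J * I => f (p.2, p.1)) l.
Proof.
pose h (p : I * J) := (p.2, p.1); pose h' (p : J * I) := Some (p.2, p.1).
by move=> /(@hasSum_pinj (J * I)%type _ h h' f l); apply => [[]|[]].
Qed.

Lemma hasSum_single (I : choiceType) (i0 : I) (c : K) :
  hasSum (fun i => if i == i0 then c else 0) c.
Proof.
move=> e e0; exists [fset i0]%fset => B; rewrite fsub1set => iB.
rewrite (big_fsetD1 i0) //= eqxx big_seq big1 ?addr0 ?subrr ?normr0 1?ltW //.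
by move=> i; rewrite !inE => /andP[/negbTE ->].
Qed.

Lemma absBounded_single (I : choiceType) (i0 : I) (c : K) :
  absBounded (fun i => if i == i0 then c else 0) `|c|.
Proof.
move=> A; have [iA|iA] := boolP (i0 \in A).
  rewrite (big_fsetD1 i0) //= eqxx big_seq big1 ?addr0 //.
  by move=> i; rewrite !inE => /andP[/negbTE ->]; rewrite normr0.
rewrite big_seq big1 // => i iA'; case: eqP => [ii|]; rewrite ?normr0 //.
by rewrite ii (negbTE iA) in iA'.
Qed.

(** The finite sums of the geometric series are bounded by 2, so completeness makes it summable, and
    the term of any index outside a sufficiently large finite set is small. *)
Lemma expr_half_small : summationComplete ->
  forall e : K, 0 < e -> exists n : nat, (2 ^- n : K) <= e.
Proof.
move=> Hs e e0; pose f (n : nat) : K := 2 ^- n.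
have f0 n : 0 < f n by rewrite invr_gt0 exprn_gt0.
have partial n : \sum_(0 <= i < n) f i = 2 - 2 * f n.
  elim: n => [|n IH]; first by rewrite big_nil /f expr0 invr1 mulr1 subrr.
  rewrite big_nat_recr //= IH /f exprS invfM mulrA divff ?pnatr_eq0 //.
  by rewrite mul1r mulr_natl mulr2n; ring.
have [l Hl] : exists l, hasSum f l.
  apply: (Hs _ _ 2) => A.
  have [N HN] : exists N, forall i, i \in A -> (i < N)%N.
    by exists (\max_(i <- A) i).+1 => i iA; rewrite ltnS; exact: (leq_bigmax_seq i (F := id)).
  have sub : (A `<=` [fset i in index_iota 0 N])%fset.
    by apply/fsubsetP => i iA; rewrite inE /= mem_index_iota HN.
  apply: le_trans (ler_sum_fsub _ sub) _ => //.
  rewrite (perm_big (index_iota 0 N)) /=; last first.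
    by apply: uniq_perm; rewrite ?fset_uniq ?iota_uniq // => i; rewrite !inE.
  rewrite (eq_bigr f) => [|i _]; last by rewrite gtr0_norm.
  by rewrite partial gerBl mulr_ge0 // ltW.
have e2 : 0 < e / 2 by rewrite divr_gt0.
have [A HA] := Hl _ e2; pose n := (\max_(i <- A) i).+1; exists n.
have nA : n \notin A by apply/negP => /(leq_bigmax_seq n (P := xpredT) (F := id)) /(_ isT); rewrite ltnn.
have := HA _ (fsubset_refl A); have := HA _ (fsubsetU1 n A).
rewrite big_fsetU1 //= -/(f n); set s := \sum_(i <- A) _ => h1 h2.
rewrite -(gtr0_norm (f0 n)) [e]splitr.
have -> : f n = (l - s) - (l - (f n + s)) by ring.
by rewrite (le_trans (ler_normB _ _)) // lerD.
Qed.

End Summation.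

(** * Completeness of the real and complex fields *)

Lemma summationComplete_real (R : realType) : summationComplete R.
Proof.
have pos (I : choiceType) (f : I -> R) (M : R) : (forall i, 0 <= f i) ->
    absBounded f M -> exists l, hasSum f l.
  move=> f0 bf.
  pose S := [set x | exists A : {fset I}, x = \sum_(i <- A) f i].
  have S0 : has_sup S.
    split; first by exists (\sum_(i <- fset0) f i), fset0.
    exists M => _ [A ->]; apply: le_trans (bf A); apply: ler_sum => i _.
    exact: ler_norm.
  exists (sup S) => e e0.
  have [_ [A ->] HA] := sup_adherent e0 S0.
  exists A => B AB; have BS : \sum_(i <- B) f i <= sup S.
    by apply: sup_upper_bound => //; exists B.
  rewrite ger0_norm ?subr_ge0 // lerBlDr -lerBlDl.
  exact: le_trans (ltW HA) (ler_sum_fsub f0 AB).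
move=> I f M bf.
(* The positive and negative parts of [f] are both dominated by its absolute value. *)
have [l1 H1] : exists l, hasSum (fun i => Num.max (f i) 0) l.
  apply: (pos _ _ M).
  by move=> i; rewrite le_max lexx orbT.
  apply: absBoundedW bf => i; rewrite ger0_norm ?le_max ?lexx ?orbT //.
  by rewrite ge_max ler_norm normr_ge0.
have [l2 H2] : exists l, hasSum (fun i => Num.max (- f i) 0) l.
  apply: (pos _ _ M).
  by move=> i; rewrite le_max lexx orbT.
  apply: absBoundedW bf => i; rewrite ger0_norm ?le_max ?lexx ?orbT //.
  by rewrite ge_max -normrN ler_norm normr_ge0.
exists (l1 + -1 * l2); apply: eq_hasSum (hasSumD H1 (hasSumZ (-1) H2)) => i.
rewrite mulN1r; case/orP: (le_total 0 (f i)) => fi.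
  by rewrite (max_l fi) max_r ?subr0 // oppr_le0.
by rewrite (max_r fi) max_l ?oppr_ge0 // sub0r opprK.
Qed.

Section ComplexCompleteness.
Local Open Scope complex_scope.

Lemma summationComplete_complex (R : realType) : summationComplete (R[i]).
Proof.
move=> I f M bf.
have M0 := absBounded_ge0 bf.
(* A nonnegative element of [R[i]] is real, so [M] is also a bound for real families. *)
have ME : M = (complex.Re M)%:C by case: M M0 {bf} => a b; rewrite lecE /= => /andP[/eqP ->].
have sumN (A : {fset I}) :
    \sum_(i <- A) `|f i| = (\sum_(i <- A) complex.Re `|f i|)%:C.
  by rewrite rmorph_sum; apply: eq_bigr => i _; case: (f i).
have bn : absBounded (fun i => complex.Re `|f i|) (complex.Re M).
  move=> A; have := bf A; rewrite ME sumN lecR => /= h; apply: le_trans h.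
  by apply: ler_sum => i _; rewrite ger0_norm //; case: (f i) => a b /=; exact: sqrtr_ge0.
have bRe : absBounded (fun i => complex.Re (f i)) (complex.Re M).
  apply: absBoundedW bn => i; case: (f i) => a b /=.
  rewrite [leRHS]ger0_norm ?sqrtr_ge0 // -sqrtr_sqr ler_sqrt ?addr_ge0 ?sqr_ge0 //.
  by rewrite lerDl sqr_ge0.
have bIm : absBounded (fun i => complex.Im (f i)) (complex.Re M).
  apply: absBoundedW bn => i; case: (f i) => a b /=.
  rewrite [leRHS]ger0_norm ?sqrtr_ge0 // -sqrtr_sqr ler_sqrt ?addr_ge0 ?sqr_ge0 //.
  by rewrite lerDr sqr_ge0.
have lift (g : I -> R) l : hasSum g l -> hasSum (fun i => (g i)%:C) (l%:C).
  move=> H e; case: e => a b; rewrite ltcE /= => /andP[/eqP -> a0].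
  have [A HA] := H a a0; exists A => B AB.
  by rewrite -rmorph_sum -rmorphB normc_def lecE /= expr0n addr0 sqrtr_sqr eqxx; exact: HA.
have [a /lift Ha] := summationComplete_real bRe.
have [b /lift Hb] := summationComplete_real bIm.
exists (a%:C + 'i * b%:C); apply: eq_hasSum (hasSumD Ha (hasSumZ 'i Hb)) => i.
by rewrite -complexE.
Qed.

End ComplexCompleteness.

(** * Absolutely convergent power series on polydiscs *)

Section PowerSeries.
Variable K : numFieldType.
Hypothesis Hs : summationComplete K.

Definition polydisc (s : nat) (r : K) (x : 'rV[K]_s) : Prop :=
  forall i, `|x ord0 i| <= r.

(** [M] bounds a weighted l1 norm of the coefficients. This norm majorizes the function on the
    closed polydisc and is submultiplicative, which is what makes products and compositions
    explicit. *)
Definition hasSeries (s : nat) (r M : K) (g : 'rV[K]_s -> K) : Prop :=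
  exists c : {ffun 'I_s -> nat} -> K,
    absBounded (fun a => c a * r ^+ mdeg a) M /\
    forall x, polydisc r x -> hasSum (fun a => c a * monom a x) (g x).

Lemma monom_norm_le (s : nat) (a : 'I_s -> nat) (r : K) (x : 'rV[K]_s) :
  polydisc r x -> `|monom a x| <= r ^+ mdeg a.
Proof.
move=> xr; rewrite normr_prod /mdeg -prodrXr; apply: ler_prod => i _.
by rewrite normrX exprn_ge0 //= lerXn2r ?nnegrE // ?xr // (le_trans _ (xr i)).
Qed.

Lemma monomD (s : nat) (a b : {ffun 'I_s -> nat}) (x : 'rV[K]_s) :
  monom [ffun i => (a i + b i)%N] x = monom a x * monom b x.
Proof.
by rewrite /monom -big_split; apply: eq_bigr => i _; rewrite ffunE exprD.
Qed.

Lemma mdegD (s : nat) (a b : {ffun 'I_s -> nat}) :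
  mdeg [ffun i => (a i + b i)%N] = (mdeg a + mdeg b)%N.
Proof. by rewrite /mdeg -big_split; apply: eq_bigr => i _; rewrite ffunE. Qed.

Lemma mdeg_eq0 (s : nat) (a : {ffun 'I_s -> nat}) :
  (mdeg a == 0)%N = (a == [ffun => 0%N]).
Proof.
rewrite /mdeg sum_nat_eq0; apply/forallP/eqP => [a0|-> i]; last by rewrite ffunE.
by apply/ffunP => i; rewrite ffunE; apply/eqP; have := a0 i.
Qed.

Lemma monom0 (s : nat) (x : 'rV[K]_s) : monom [ffun => 0%N] x = 1.
Proof. by rewrite /monom big1 // => i _; rewrite ffunE expr0. Qed.

Lemma term_norm_le (s : nat) (c : {ffun 'I_s -> nat} -> K) (r : K) (x : 'rV[K]_s) a :
  polydisc r x -> `|c a * monom a x| <= `|c a * r ^+ mdeg a|.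
Proof.
move=> xr; rewrite !normrM ler_wpM2l //; apply: le_trans (monom_norm_le _ xr) _.
by rewrite real_ler_norm // ger0_real // (le_trans _ (monom_norm_le a xr)).
Qed.

Lemma hasSeries_norm_le (s : nat) (r M : K) (g : 'rV[K]_s -> K) x :
  hasSeries r M g -> polydisc r x -> `|g x| <= M.
Proof.
move=> [c [bc Hc]] xr; apply: hasSum_norm_le (Hc x xr).
by apply: absBoundedW bc => a; exact: term_norm_le.
Qed.

Lemma hasSeries_ge0 (s : nat) (r M : K) (g : 'rV[K]_s -> K) : hasSeries r M g -> 0 <= M.
Proof. by case=> c [/absBounded_ge0]. Qed.

Lemma eq_hasSeries (s : nat) (r M : K) (g h : 'rV[K]_s -> K) :
  (forall x, polydisc r x -> g x = h x) -> hasSeries r M g -> hasSeries r M h.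
Proof. by move=> gh [c [bc Hc]]; exists c; split=> // x xr; rewrite -gh //; exact: Hc. Qed.

Lemma hasSeries_le (s : nat) (r r' M M' : K) (g : 'rV[K]_s -> K) :
  0 <= r' -> r' <= r -> M <= M' -> hasSeries r M g -> hasSeries r' M' g.
Proof.
move=> r'0 rr MM [c [bc Hc]]; exists c; split=> [A|x xr].
  apply: le_trans MM; apply: le_trans (bc A); apply: ler_sum => a _.
  rewrite !normrM ler_wpM2l // !ger0_norm ?exprn_ge0 //; last exact: le_trans rr.
  by rewrite lerXn2r ?nnegrE // (le_trans r'0).
by apply: Hc => i; apply: le_trans (xr i) rr.
Qed.

(* Closure under absolutely convergent series of functions: this single fact
   yields both products and compositions of power series. *)
Lemma hasSeries_hasSum (I : choiceType) (s : nat) (r M : K) (m : I -> K)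
    (G : I -> 'rV[K]_s -> K) (g : 'rV[K]_s -> K) :
  0 < r -> (forall i, hasSeries r (m i) (G i)) -> absBounded m M ->
  (forall x, polydisc r x -> hasSum (G^~ x) (g x)) -> hasSeries r M g.
Proof.
move=> r0 /choice[c Hc] bm Hg.
(* Coefficients are weighted by [r ^+ mdeg a], so that summing over [I] keeps the bound [M]; the
   weight is divided out of the resulting coefficients. *)
pose F (p : {ffun 'I_s -> nat} * I) := c p.2 p.1 * r ^+ mdeg p.1.
have rd (a : {ffun 'I_s -> nat}) : r ^+ mdeg a != 0 by rewrite expf_neq0 ?gt_eqF.
have bF : absBounded F M.
  have bF' : absBounded (fun p => F (p.2, p.1)) M.
    by apply: absBounded_pair bm => i; case: (Hc i).
  have := absBounded_pinj (h := fun p => (p.2, p.1)) (h' := fun p => Some (p.2, p.1)) _ bF'.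
  by move=> /(_ ltac:(by case)) bF2 A; apply: le_trans (bF2 A); apply: ler_sum => -[].
have row a : absBounded (fun i => F (a, i)) M.
  move=> A; apply: le_trans (bm A); apply: ler_sum => i _.
  have [bi _] := Hc i; have := bi [fset a]%fset; rewrite big_seq_fset1 => h.
  by apply: le_trans h _; rewrite real_ler_norm // ger0_real // (absBounded_ge0 bi).
have /choice[e He] : forall a, exists l, hasSum (fun i => F (a, i)) l.
  by move=> a; exact: (Hs (row a)).
exists (fun a => e a / r ^+ mdeg a); split.
  apply: absBoundedW (absBounded_rows bF He) => a.
  by rewrite divfK.
(* Summed over exponents first, [Fx] gives [g x]; summed over [I] first, it gives the new power
   series. *)
move=> x xr; pose Fx (p : I * {ffun 'I_s -> nat}) := c p.1 p.2 * monom p.2 x.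
have bFx : absBounded Fx M.
  apply: absBounded_pair bm => i; have [bi _] := Hc i.
  by apply: absBoundedW bi => a; exact: term_norm_le.
have [L HL] := Hs bFx.
have -> : g x = L.
  apply: hasSum_unique (Hg x xr) (hasSum_fubini HL _) => i.
  by have [_] := Hc i; apply.
apply: hasSum_fubini (hasSum_swap HL) _ => a /=.
rewrite (_ : _ * _ = monom a x / r ^+ mdeg a * e a); last by field; rewrite rd.
apply: eq_hasSum (hasSumZ _ (He a)) => i; rewrite /F /Fx /=.
by field; rewrite rd.
Qed.

Lemma hasSeries_monomM (s : nat) (r M : K) (b : {ffun 'I_s -> nat}) (g : 'rV[K]_s -> K) :
  0 < r -> hasSeries r M g ->
  hasSeries r (r ^+ mdeg b * M) (fun x => monom b x * g x).
Proof.
move=> r0 [c [bc Hc]].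
pose h (a : {ffun 'I_s -> nat}) := [ffun i => (a i + b i)%N].
pose h' (a : {ffun 'I_s -> nat}) :=
  if [forall i, b i <= a i]%N then Some [ffun i => (a i - b i)%N] else None.
have hK : pcancel h h'.
  move=> a; rewrite /h' ifT; last by apply/forallP => i; rewrite ffunE leq_addl.
  by congr Some; apply/ffunP => i; rewrite !ffunE addnK.
have h'K : ocancel h' h.
  move=> a; rewrite /h'; case: ifP => //= /forallP ba.
  by apply/ffunP => i; rewrite !ffunE subnK.
exists (fun a => oapp c 0 (h' a)); split.
  have := absBounded_pinj h'K (absBoundedZ (r ^+ mdeg b) bc).
  rewrite ger0_norm ?exprn_ge0 ?ltW //; apply: absBoundedW => a.
  case: (h' a) (h'K a) => [a'|] /=; last by rewrite mul0r.
  move=> <-; rewrite /h mdegD exprD le_eqVlt; apply/orP; left; apply/eqP.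
  by congr `|_|; ring.
move=> x xr; have := hasSum_pinj hK h'K (hasSumZ (monom b x) (Hc x xr)).
apply: eq_hasSum => a.
case: (h' a) (h'K a) => [a'|] /=; last by rewrite mul0r.
by move=> <-; rewrite /h monomD; ring.
Qed.

Lemma hasSeriesZ (s : nat) (r M k : K) (g : 'rV[K]_s -> K) :
  hasSeries r M g -> hasSeries r (`|k| * M) (fun x => k * g x).
Proof.
move=> [c [bc Hc]]; exists (fun a => k * c a); split.
  by apply: absBoundedW (absBoundedZ k bc) => a; rewrite mulrA.
by move=> x xr; apply: eq_hasSum (hasSumZ k (Hc x xr)) => a; rewrite mulrA.
Qed.

Lemma hasSeriesD (s : nat) (r M M' : K) (g h : 'rV[K]_s -> K) :
  hasSeries r M g -> hasSeries r M' h -> hasSeries r (M + M') (fun x => g x + h x).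
Proof.
move=> [c [bc Hc]] [d [bd Hd]]; exists (fun a => c a + d a); split.
  move=> A; apply: le_trans (lerD (bc A) (bd A)); rewrite -big_split.
  by apply: ler_sum => a _; rewrite mulrDl ler_normD.
by move=> x xr; apply: eq_hasSum (hasSumD (Hc x xr) (Hd x xr)) => a; rewrite mulrDl.
Qed.

Lemma hasSeries_cst (s : nat) (r k : K) : hasSeries r `|k| (fun _ : 'rV[K]_s => k).
Proof.
exists (fun a => if a == [ffun => 0%N] then k else 0); split.
  apply: absBoundedW (absBounded_single [ffun => 0%N] k) => a.
  by case: eqP => [->|]; rewrite ?mul0r // (eqP (_ : mdeg _ == 0)%N) ?mulr1 ?mdeg_eq0.
move=> x _; apply: eq_hasSum (hasSum_single [ffun => 0%N] k) => a.
by case: eqP => [->|]; rewrite ?mul0r // monom0 mulr1.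
Qed.

Lemma hasSeries_coord (s : nat) (r : K) (i : 'I_s) :
  0 < r -> hasSeries r r (fun x => x ord0 i).
Proof.
move=> r0; pose b : {ffun 'I_s -> nat} := [ffun j => (j == i) : nat].
have := hasSeries_monomM b r0 (hasSeries_cst s r 1).
have -> : mdeg b = 1%N.
  rewrite /mdeg (bigD1 i) //= ffunE eqxx big1 ?addn0 // => j /negbTE ji.
  by rewrite ffunE ji.
rewrite expr1 normr1 mulr1; apply: eq_hasSeries => x _; rewrite mulr1 /monom (bigD1 i) //=.
by rewrite ffunE eqxx big1 ?mulr1 // => j /negbTE ji; rewrite ffunE ji.
Qed.

Lemma hasSeriesM (s : nat) (r M M' : K) (g h : 'rV[K]_s -> K) :
  0 < r -> hasSeries r M g -> hasSeries r M' h -> hasSeries r (M * M') (fun x => g x * h x).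
Proof.
move=> r0 [c [bc Hc]] Hh; have M'0 := hasSeries_ge0 Hh.
apply: (hasSeries_hasSum (m := fun a => `|c a| * (r ^+ mdeg a * M'))
  (G := fun (a : {ffun 'I_s -> nat}) x => c a * (monom a x * h x))) => //.
- by move=> a; apply: hasSeriesZ; exact: hasSeries_monomM.
- have := absBoundedZ M' bc; rewrite ger0_norm // mulrC; apply: absBoundedW => a.
  by rewrite !normrM normr_id (ger0_norm M'0) mulrA [leRHS]mulrC.
- move=> x xr; have := hasSumZ (h x) (Hc x xr); rewrite mulrC.
  by apply: eq_hasSum => a; rewrite mulrC mulrA.
Qed.

Lemma hasSeries_prodX (s t : nat) (r M : K) (G : 'I_t -> 'rV[K]_s -> K) (b : 'I_t -> nat) :
  0 < r -> (forall j, hasSeries r M (G j)) ->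
  hasSeries r (M ^+ mdeg b) (fun x => \prod_(j < t) G j x ^+ b j).
Proof.
move=> r0 HG; rewrite /mdeg -prodrXr.
elim: (index_enum _) => [|j l IH].
  rewrite big_nil -[X in hasSeries _ X](normr1 K).
  by apply: eq_hasSeries (hasSeries_cst s r 1) => x _; rewrite big_nil.
rewrite big_cons.
apply: (@eq_hasSeries _ _ _ (fun x => G j x ^+ b j * \prod_(j <- l) G j x ^+ b j)).
  by move=> x _; rewrite big_cons.
apply: hasSeriesM => //; elim: (b j) => [|n IHn].
  rewrite expr0 -[X in hasSeries _ X](normr1 K).
  by apply: eq_hasSeries (hasSeries_cst s r 1) => x _; rewrite expr0.
rewrite exprS; apply: eq_hasSeries (hasSeriesM r0 (HG j) IHn) => x _.
by rewrite exprS.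
Qed.

(** Each component of [G] has norm at most [sg], so substituting [G] into a monomial of degree [d]
    gives norm at most [sg ^+ d], and the series of [q] converges in norm. *)
Lemma hasSeries_comp (s t : nat) (r M sg : K) (q : 'rV[K]_t -> K)
    (G : 'rV[K]_s -> 'rV[K]_t) :
  0 < r -> (forall j, hasSeries r sg (Defs.comp G j)) -> hasSeries sg M q ->
  hasSeries r M (q \o G).
Proof.
move=> r0 HG [c [bc Hc]].
apply: (hasSeries_hasSum (m := fun b => `|c b| * sg ^+ mdeg b)
  (G := fun (b : {ffun 'I_t -> nat}) x => c b * \prod_(j < t) Defs.comp G j x ^+ b j)) => //.
- by move=> b; apply: hasSeriesZ; exact: hasSeries_prodX.
- by apply: absBoundedW bc => b; rewrite !normrM normr_id.
- by move=> x xr; apply: Hc => j; exact: hasSeries_norm_le (HG j) xr.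
Qed.

Lemma monom_at0 (s : nat) (a : {ffun 'I_s -> nat}) : a != [ffun => 0%N] -> monom a (0 : 'rV[K]_s) = 0.
Proof.
rewrite -mdeg_eq0 sum_nat_eq0 negb_forall => /existsP[i /= ai].
by rewrite /monom (bigD1 i) //= mxE expr0n (negbTE ai) mul0r.
Qed.

(** Without a constant term every monomial has positive degree, so scaling the radius by [k <= 1]
    scales the norm by at least as good a factor. *)
Lemma hasSeries_shrink (s : nat) (r M sg : K) (g : 'rV[K]_s -> K) :
  0 < r -> 0 < sg -> g 0 = 0 -> hasSeries r M g ->
  exists r' : K, [/\ 0 < r', r' <= r & forall r'', 0 < r'' -> r'' <= r' -> hasSeries r'' sg g].
Proof.
move=> r0 sg0 g0 Hg; have M0 := hasSeries_ge0 Hg; case: Hg => c [bc Hc].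
have c0 : c [ffun => 0%N] = 0.
  rewrite -g0; apply: hasSum_unique (Hc 0 _); last by move=> i; rewrite mxE normr0 ltW.
  apply: eq_hasSum (hasSum_single [ffun => 0%N] _) => a.
  by case: eqP => [->|/eqP/monom_at0 ->]; rewrite ?mulr0 // monom0 mulr1.
have Msg : 0 < M + sg by rewrite ltr_wpDl.
have [k [k0 k1 kM]] : exists k : K, [/\ 0 < k, k <= 1 & k * M <= sg].
  (* The denominator [M + sg] rather than [M] covers [M = 0] and keeps [k <= 1]. *)
  exists (sg / (M + sg)); split; first by rewrite divr_gt0.
    by rewrite ler_pdivrMr // mul1r lerDr.
  by rewrite mulrAC ler_pdivrMr // ler_pM2l // lerDl ltW.
have rk : r * k <= r by rewrite ger_pMr.
exists (r * k); split=> //; first by rewrite mulr_gt0.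
move=> r'' r''0 r''r; apply: (@hasSeries_le _ (r * k) r'' sg) => //; first exact: ltW.
exists c; split; last first.
  by move=> x xr; apply: Hc => i; apply: le_trans (xr i) rk.
have := absBoundedZ k bc; rewrite gtr0_norm // => bk A.
apply: le_trans kM; apply: le_trans (bk A); apply: ler_sum => a _.
have [->|a0] := eqVneq a [ffun => 0%N]; first by rewrite c0 !mul0r mulr0.
rewrite exprMn (_ : c a * _ = k ^+ mdeg a * (c a * r ^+ mdeg a)); last by ring.
rewrite [leLHS]normrM [leRHS]normrM (gtr0_norm k0).
rewrite ler_wpM2r // normrX (gtr0_norm k0).
move: a0; rewrite -mdeg_eq0; case: (mdeg a) => // n _.
by rewrite exprS ler_piMr ?(ltW k0) // exprn_ile1 // ltW.
Qed.

(** * Division by coordinates *)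

Definition zeroOn (s : nat) (P : pred 'I_s) (x : 'rV[K]_s) : 'rV[K]_s :=
  \row_i (if P i then 0 else x ord0 i).

(** Monomials free of [x_i] make up the restriction to [x_i = 0]; the others are divided by [x_i],
    each losing one factor [r] in the norm, whence [M / r]. *)
Lemma hasSeries_hadamard1 (s : nat) (r M : K) (g : 'rV[K]_s -> K) (i : 'I_s) :
  0 < r -> hasSeries r M g ->
  exists T : 'rV[K]_s -> K, hasSeries r (M / r) T /\
    forall x, polydisc r x -> g x = g (zeroOn (pred1 i) x) + x ord0 i * T x.
Proof.
move=> r0 [c [bc Hc]].
pose b : {ffun 'I_s -> nat} := [ffun j => (j == i) : nat].
pose h (a : {ffun 'I_s -> nat}) : {ffun 'I_s -> nat} := [ffun j => (a j + b j)%N].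
pose h' (a : {ffun 'I_s -> nat}) : option {ffun 'I_s -> nat} :=
  if (0 < a i)%N then Some [ffun j => (a j - b j)%N] else None.
have hK : pcancel h h'.
  move=> a; rewrite /h' ifT; last by rewrite !ffunE eqxx addn1.
  by congr Some; apply/ffunP => j; rewrite !ffunE addnK.
have h'K : ocancel h' h.
  move=> a; rewrite /h'; case: ifP => //= a0.
  by apply/ffunP => j; rewrite !ffunE subnK //; case: eqP => // ->.
have hE a : mdeg (h a) = (mdeg a).+1.
  rewrite /h mdegD (_ : mdeg b = 1%N) ?addn1 // /mdeg (bigD1 i) //= ffunE eqxx.
  by rewrite big1 ?addn0 // => j /negbTE ji; rewrite ffunE ji.
have bE x : monom b x = x ord0 i.
  rewrite /monom (bigD1 i) //= ffunE eqxx big1 ?mulr1 // => j /negbTE ji.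
  by rewrite ffunE ji.
have bc' : absBounded (fun a => c (h a) * r ^+ mdeg a) (M / r).
  move=> A; rewrite ler_pdivlMr // mulr_suml.
  apply: le_trans (bc (h @` A)%fset); rewrite big_imfset /=; last first.
    by move=> a1 a2 _ _ /(congr1 h'); rewrite !hK => -[].
  apply: ler_sum => a _; rewrite hE exprSr mulrA [in leRHS]normrM.
  by rewrite (gtr0_norm r0).
(* Outside the polydisc [T] takes the default value 0. *)
have /choice[T HT] : forall x, exists l, polydisc r x ->
    hasSum (fun a => c (h a) * monom a x) l.
  move=> x; have [xr|nxr] := pselect (polydisc r x); last by exists 0.
  have [|l Hl] := Hs (f := fun a => c (h a) * monom a x) (M := M / r).
    by apply: absBoundedW bc' => a; exact: (term_norm_le (fun a => c (h a)) _ xr).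
  by exists l.
exists T; split; first by exists (fun a => c (h a)).
move=> x xr; apply: hasSum_unique (Hc x xr) _.
have x0r : polydisc r (zeroOn (pred1 i) x).
  by move=> j; rewrite mxE; case: ifP => _; [rewrite normr0 ltW|exact: xr].
have := hasSumD (Hc _ x0r) (hasSum_pinj hK h'K (hasSumZ (x ord0 i) (HT x xr))).
apply: eq_hasSum => a; have [a0|a0] := posnP (a i).
  rewrite /h' a0 /= addr0; congr (_ * _); apply: eq_bigr => j _.
  by rewrite mxE /=; case: eqP => // ->; rewrite a0 !expr0.
rewrite /monom (bigD1 i) //= mxE /= eqxx expr0n gtn_eqF // mul0r mulr0 add0r.
have := h'K a; case ha: (h' a) => [a'|] /=; last by move: ha; rewrite /h' a0.
by move=> <-; rewrite -/(monom a' x) -/(monom (h a') x) monomD bE; ring.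
Qed.

End PowerSeries.

(** * Analytic germs *)

Section AnalyticGerms.
Variable K : numFieldType.
Hypothesis Hs : summationComplete K.

(** The order of [K] is only partial; two positive elements are comparable because both are real. *)
Lemma pos_lower_bound (a b : K) : 0 < a -> 0 < b -> exists c : K, [/\ 0 < c, c <= a & c <= b].
Proof.
move=> a0 b0; have /orP[ab|ba] := real_leVge (gtr0_real a0) (gtr0_real b0).
  by exists a.
by exists b.
Qed.

Lemma pos_lower_bound_seq (I : eqType) (l : seq I) (r : I -> K) :
  (forall i, 0 < r i) -> exists c : K, 0 < c /\ forall i, i \in l -> c <= r i.
Proof.
move=> r0; elim: l => [|i l [c [c0 Hc]]]; first by exists 1.
have [d [d0 dc di]] := pos_lower_bound c0 (r0 i); exists d; split=> // j.
by rewrite inE => /orP[/eqP ->//|/Hc]; exact: le_trans.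
Qed.

Lemma near0_polydisc (s : nat) (P : 'rV[K]_s -> Prop) :
  (\forall x \near (0 : 'rV[K]_s), P x) <->
  exists r : K, 0 < r /\ forall x, polydisc r x -> P x.
Proof.
split=> [/nbhs_ballP[e /= e0 He]|[r [r0 Hr]]].
  exists (e / 2); split=> [|x xe]; first by rewrite divr_gt0.
  apply: He; split=> // i j; rewrite ord1 mxE /ball /= sub0r normrN.
  by apply: le_lt_trans (xe j) _; rewrite ltr_pdivrMr // ltr_pMr // ltr1n.
apply/nbhs_ballP; exists r => //= x [_ xr]; apply: Hr => i.
by have := xr ord0 i; rewrite mxE /ball /= sub0r normrN => /ltW.
Qed.

Definition boxed (s N : nat) (a : {ffun 'I_s -> 'I_N.+1}) : {ffun 'I_s -> nat} :=
  [ffun i => a i : nat].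

Lemma boxed_inj (s N : nat) : injective (@boxed s N).
Proof.
by move=> a b /ffunP ab; apply/ffunP => i; have := ab i; rewrite !ffunE => /val_inj.
Qed.

Lemma boxedK (s N : nat) (a : {ffun 'I_s -> nat}) :
  (forall i, a i <= N)%N -> boxed [ffun i => inord (a i) : 'I_N.+1] = a.
Proof. by move=> aN; apply/ffunP => i; rewrite !ffunE inordK // ltnS. Qed.

Lemma mdeg_ge (s : nat) (a : 'I_s -> nat) i : (a i <= mdeg a)%N.
Proof. by rewrite /mdeg (bigD1 i) //= leq_addr. Qed.

(** The index set of [psum] as a finite set of exponents: the partial sums by degree become
    instances of the finite sums in [hasSum]. *)
Definition simplex (s N : nat) : {fset {ffun 'I_s -> nat}} :=
  [fset a in [seq boxed a | a <- enum [pred a : {ffun 'I_s -> 'I_N.+1} | (mdeg (boxed a) <= N)%N]]]%fset.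

Lemma in_simplex (s N : nat) (a : {ffun 'I_s -> nat}) : (a \in simplex s N) = (mdeg a <= N)%N.
Proof.
rewrite inE /=; apply/mapP/idP => [[b]|aN]; first by rewrite mem_enum inE => bN ->.
exists [ffun i => inord (a i)]; last by rewrite boxedK // => i; exact: leq_trans (mdeg_ge a i) aN.
by rewrite mem_enum inE boxedK // => i; exact: leq_trans (mdeg_ge a i) aN.
Qed.

Lemma psum_simplex (s N : nat) (c : ('I_s -> nat) -> K) (x : 'rV[K]_s) :
  psum c x N = \sum_(a <- simplex s N) c a * monom a x.
Proof.
have E (a : {ffun 'I_s -> 'I_N.+1}) : (fun i => nat_of_ord (a i)) = boxed a.
  by apply/funext => i; rewrite ffunE.
rewrite /psum.
transitivity (\sum_(b <- [seq boxed a | a <- enum [pred a : {ffun 'I_s -> 'I_N.+1} | (mdeg (boxed a) <= N)%N]])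
   c b * monom b x).
  rewrite big_map big_enum /=; apply: eq_big => a.
    by rewrite inE E.
  by move=> _; rewrite E.
apply: perm_big; apply: uniq_perm.
- by rewrite map_inj_uniq ?enum_uniq //; exact: boxed_inj.
- exact: fset_uniq.
- by move=> a; apply/esym; rewrite inE.
Qed.

Lemma hasSum_psum (s : nat) (c : ('I_s -> nat) -> K) (x : 'rV[K]_s) (l : K) :
  hasSum (fun a : {ffun 'I_s -> nat} => c a * monom a x) l -> psum c x @ \oo --> l.
Proof.
move=> H; apply/cvgrPdist_le => e e0; have [A HA] := H e e0.
exists (\max_(a <- A) mdeg a)%N => // N /= hN; rewrite psum_simplex; apply: HA.
apply/fsubsetP => a aA; rewrite in_simplex; apply: leq_trans hN.
exact: (leq_bigmax_seq a (F := fun a : {ffun 'I_s -> nat} => mdeg a)).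
Qed.

Lemma geometric_sum_le2 (t : K) (n : nat) : 0 <= t -> t <= 2^-1 -> \sum_(k < n) t ^+ k <= 2.
Proof.
move=> t0 t2; elim: n => [|n IH]; first by rewrite big_ord0.
rewrite big_ord_recl expr0 (_ : (2 : K) = 1 + 2^-1 * 2); last by rewrite mulVf // -mulr2n.
rewrite lerD2l; under eq_bigr do rewrite lift0 exprS.
by rewrite -mulr_sumr ler_pM // sumr_ge0 // => k _; rewrite exprn_ge0.
Qed.

(** Over a box of exponents the sum factors into [s] one-variable geometric sums, each at most 2. *)
Lemma absBounded_geometric (s : nat) (t : K) : 0 <= t -> t <= 2^-1 ->
  absBounded (fun a : {ffun 'I_s -> nat} => t ^+ mdeg a) (2 ^+ s).
Proof.
move=> t0 t2 A.
have [N HN] : exists N, forall a : {ffun 'I_s -> nat}, a \in A -> forall i, (a i <= N)%N.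
  exists (\max_(a <- A) mdeg a)%N => a aA i; apply: leq_trans (mdeg_ge a i) _.
  exact: (leq_bigmax_seq a (F := fun a : {ffun 'I_s -> nat} => mdeg a)).
have sub : (A `<=` [fset a in [seq boxed a | a <- enum {ffun 'I_s -> 'I_N.+1}]])%fset.
  apply/fsubsetP => a aA; rewrite inE /=; apply/mapP.
  exists [ffun i => inord (a i)]; first by rewrite mem_enum.
  by rewrite boxedK //; exact: HN.
apply: le_trans (ler_sum_fsub _ sub) _ => //.
rewrite (perm_big [seq boxed a | a <- enum {ffun 'I_s -> 'I_N.+1}]) /=; last first.
  apply: uniq_perm; [exact: fset_uniq| |by move=> a; rewrite inE].
  by rewrite map_inj_uniq ?enum_uniq //; exact: boxed_inj.
rewrite big_map big_enum /=.
rewrite (eq_bigr (fun a : {ffun 'I_s -> 'I_N.+1} => \prod_(i < s) t ^+ a i)); last first.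
  move=> a _; rewrite ger0_norm ?exprn_ge0 // prodrXr; congr (_ ^+ _).
  by apply: eq_bigr => i _; rewrite ffunE.
rewrite -(bigA_distr_bigA (fun (i : 'I_s) (k : 'I_N.+1) => t ^+ k)).
rewrite -[X in 2 ^+ X]card_ord -prodr_const; apply: ler_prod => i _.
rewrite geometric_sum_le2 // andbT.
by apply: sumr_ge0 => k _; rewrite exprn_ge0.
Qed.

(** A bound on the individual terms at radius [r] becomes summability at radius at most [r / 2], by
    comparison with a geometric series; conversely each term is bounded by the whole sum. The value
    is the same because limits are unique. *)
Lemma analytic0P (s : nat) (g : 'rV[K]_s -> K) :
  analytic0 g <-> exists r M : K, 0 < r /\ hasSeries r M g.
Proof.
split=> [[c [[r [M [r0 bc]]] /near0_polydisc[r1 [r10 Hg]]]]|[r [M [r0 [c [bc Hc]]]]]].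
  have r2 : 0 < r / 2 by rewrite divr_gt0.
  have [q [q0 qr qr1]] := pos_lower_bound r2 r10.
  exists q, (M * 2 ^+ s); split=> //.
  have M0 : 0 <= M by apply: le_trans (bc (fun=> 0%N)); rewrite mulr_ge0 // exprn_ge0 // ltW.
  have bq : absBounded (fun a : {ffun 'I_s -> nat} => c a * q ^+ mdeg a) (M * 2 ^+ s).
    have t0 : 0 <= q / r by rewrite divr_ge0 // ltW.
    have t1 : q / r <= 2^-1 by rewrite ler_pdivrMr // mulrC.
    rewrite -{1}(ger0_norm M0).
    apply: absBoundedW (absBoundedZ M (@absBounded_geometric s _ t0 t1)) => a.
    rewrite [leRHS]normrM (ger0_norm M0) expr_div_n [leLHS]normrM.
    rewrite [in leRHS]normrM normfV [X in _ / X]ger0_norm ?exprn_ge0 ?(ltW r0) //.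
    rewrite mulrCA mulrC ler_wpM2l // ler_pdivlMr ?exprn_gt0 //.
  exists (fun a => c a); split=> // x xq.
  have [|l Hl] := Hs (f := fun a : {ffun 'I_s -> nat} => c a * monom a x) (M := M * 2 ^+ s).
    by apply: absBoundedW bq => a; exact: (term_norm_le (fun a : {ffun 'I_s -> nat} => c a) _ xq).
  rewrite (_ : g x = l) //; apply: (cvg_unique (@norm_hausdorff K K)) (hasSum_psum Hl).
  by apply: Hg => i; exact: le_trans (xq i) qr1.
have fE (a : {ffun 'I_s -> nat}) : [ffun i => a i] = a by apply/ffunP => i; rewrite ffunE.
exists (fun a => c [ffun i => a i]); split.
  exists r, M; split=> // a; have := bc [fset [ffun i => a i]]%fset.
  rewrite big_seq_fset1 normrM [X in _ * X]ger0_norm ?exprn_ge0 ?(ltW r0) //.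
  by rewrite /mdeg; under eq_bigr do rewrite ffunE.
apply/near0_polydisc; exists r; split=> // x xr; apply: hasSum_psum.
by apply: eq_hasSum (Hc x xr) => a; rewrite fE.
Qed.

Lemma analytic0_germ (s : nat) (g h : 'rV[K]_s -> K) :
  germ_eq g h -> analytic0 g -> analytic0 h.
Proof.
move=> gh [c [bc Hc]]; exists c; split=> //; move: gh Hc; apply: filterS2 => x /= ->.
exact.
Qed.

Lemma eq_analytic0 (s : nat) (g h : 'rV[K]_s -> K) : g =1 h -> analytic0 g -> analytic0 h.
Proof. by move=> gh; apply: analytic0_germ; apply: filterE. Qed.

Lemma analytic0_common (s : nat) (g h : 'rV[K]_s -> K) : analytic0 g -> analytic0 h ->
  exists r M M' : K, [/\ 0 < r, hasSeries r M g & hasSeries r M' h].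
Proof.
move=> /analytic0P[r [M [r0 Hg]]] /analytic0P[r' [M' [r'0 Hh]]].
have [q [q0 qr qr']] := pos_lower_bound r0 r'0; exists q, M, M'; split=> //.
  exact: hasSeries_le (ltW q0) qr (lexx M) Hg.
exact: hasSeries_le (ltW q0) qr' (lexx M') Hh.
Qed.

Lemma analytic0D (s : nat) (g h : 'rV[K]_s -> K) :
  analytic0 g -> analytic0 h -> analytic0 (fun x => g x + h x).
Proof.
move=> /analytic0_common H /H[r [M [M' [r0 Hg Hh]]]]; apply/analytic0P.
by exists r, (M + M'); split=> //; exact: hasSeriesD.
Qed.

Lemma analytic0M (s : nat) (g h : 'rV[K]_s -> K) :
  analytic0 g -> analytic0 h -> analytic0 (fun x => g x * h x).
Proof.
move=> /analytic0_common H /H[r [M [M' [r0 Hg Hh]]]]; apply/analytic0P.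
by exists r, (M * M'); split=> //; exact: hasSeriesM.
Qed.

Lemma analytic0_cst (s : nat) (k : K) : analytic0 (fun _ : 'rV[K]_s => k).
Proof. by apply/analytic0P; exists 1, `|k|; split=> //; exact: hasSeries_cst. Qed.

Lemma analytic0_coord (s : nat) (i : 'I_s) : analytic0 (fun x : 'rV[K]_s => x ord0 i).
Proof. by apply/analytic0P; exists 1, 1; split=> //; exact: hasSeries_coord. Qed.

Lemma analytic0N (s : nat) (g : 'rV[K]_s -> K) : analytic0 g -> analytic0 (fun x => - g x).
Proof.
move=> Hg; apply: eq_analytic0 (analytic0M (analytic0_cst s (-1)) Hg) => x.
by rewrite mulN1r.
Qed.

Lemma analytic0B (s : nat) (g h : 'rV[K]_s -> K) :
  analytic0 g -> analytic0 h -> analytic0 (fun x => g x - h x).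
Proof. by move=> Hg Hh; apply: analytic0D => //; exact: analytic0N. Qed.

Lemma analytic0_sum (s : nat) (I : Type) (l : seq I) (P : pred I) (g : I -> 'rV[K]_s -> K) :
  (forall i, analytic0 (g i)) -> analytic0 (fun x => \sum_(i <- l | P i) g i x).
Proof.
move=> Hg; elim: l => [|i l IH].
  by apply: eq_analytic0 (analytic0_cst s 0) => x; rewrite big_nil.
have [Pi|/negbTE nPi] := boolP (P i).
  by apply: eq_analytic0 (analytic0D (Hg i) IH) => x; rewrite big_cons Pi.
by apply: eq_analytic0 IH => x; rewrite big_cons nPi.
Qed.

Lemma analytic0_monom (s : nat) (a : 'I_s -> nat) : analytic0 (@monom K s a).
Proof.
rewrite /monom; elim: (index_enum _) => [|i l IH].
  by apply: eq_analytic0 (analytic0_cst s 1) => x; rewrite big_nil.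
have Xi : analytic0 (fun x : 'rV[K]_s => x ord0 i ^+ a i).
  elim: (a i) => [|n IHn]; first by apply: eq_analytic0 (analytic0_cst s 1) => x.
  by apply: eq_analytic0 (analytic0M (analytic0_coord i) IHn) => x; rewrite exprS.
by apply: eq_analytic0 (analytic0M Xi IH) => x; rewrite big_cons.
Qed.

Lemma analytic_map_shrink (s t : nat) (G : 'rV[K]_s -> 'rV[K]_t) (sg : K) :
  0 < sg -> G 0 = 0 -> (forall j, analytic0 (Defs.comp G j)) ->
  exists r : K, 0 < r /\ forall j, hasSeries r sg (Defs.comp G j).
Proof.
move=> sg0 G0 HG.
have /choice[r Hr] : forall j, exists r : K, 0 < r /\
    forall q, 0 < q -> q <= r -> hasSeries q sg (Defs.comp G j).
  move=> j; have /analytic0P[r [M [r0 Hj]]] := HG j.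
  have Gj0 : Defs.comp G j 0 = 0 by rewrite /Defs.comp G0 mxE.
  by have [q [q0 _ Hq]] := hasSeries_shrink r0 sg0 Gj0 Hj; exists q.
have [q [q0 Hq]] := pos_lower_bound_seq (enum 'I_t) (fun j => proj1 (Hr j)).
by exists q; split=> // j; apply: (proj2 (Hr j)) => //; rewrite Hq // mem_enum.
Qed.

Lemma analytic0_comp (s t : nat) (G : 'rV[K]_s -> 'rV[K]_t) (q : 'rV[K]_t -> K) :
  analytic0 q -> G 0 = 0 -> (forall j, analytic0 (Defs.comp G j)) ->
  analytic0 (fun x => q (G x)).
Proof.
move=> /analytic0P[r [M [r0 Hq]]] G0 /(analytic_map_shrink r0 G0)[r' [r'0 HG]].
by apply/analytic0P; exists r', M; split=> //; exact: hasSeries_comp HG Hq.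
Qed.

Lemma near0_comp (s t : nat) (G : 'rV[K]_s -> 'rV[K]_t) (P : 'rV[K]_t -> Prop) :
  G 0 = 0 -> (forall j, analytic0 (Defs.comp G j)) ->
  (\forall y \near (0 : 'rV[K]_t), P y) -> \forall x \near (0 : 'rV[K]_s), P (G x).
Proof.
move=> G0 HG /near0_polydisc[r [r0 HP]].
have [q [q0 Hq]] := analytic_map_shrink r0 G0 HG.
apply/near0_polydisc; exists q; split=> // x xq; apply: HP => j.
exact: hasSeries_norm_le (Hq j) xq.
Qed.

Lemma analytic0_zeroOn (s : nat) (P : pred 'I_s) j :
  analytic0 (Defs.comp (@zeroOn K s P) j).
Proof.
case Pj : (P j).
  by apply: eq_analytic0 (analytic0_cst s 0) => x; rewrite /Defs.comp mxE Pj.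
by apply: eq_analytic0 (analytic0_coord j) => x; rewrite /Defs.comp mxE Pj.
Qed.

Lemma zeroOn0 (s : nat) (P : pred 'I_s) : zeroOn P 0 = 0 :> 'rV[K]_s.
Proof. by apply/rowP => i; rewrite !mxE if_same. Qed.

Lemma analytic0_hadamard (s : nat) (g : 'rV[K]_s -> K) (P : pred 'I_s) :
  analytic0 g ->
  exists T : 'I_s -> 'rV[K]_s -> K, (forall i, analytic0 (T i)) /\
    \forall x \near (0 : 'rV[K]_s),
      g x = g (zeroOn P x) + \sum_(i | P i) x ord0 i * T i x.
Proof.
move=> Hg.
suff : forall l, uniq l -> exists T : 'I_s -> 'rV[K]_s -> K, (forall i, analytic0 (T i)) /\
    \forall x \near (0 : 'rV[K]_s),
      g x = g (zeroOn (mem l) x) + \sum_(i <- l) x ord0 i * T i x.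
  move=> /(_ (enum P) (enum_uniq _))[T [HT H]]; exists T; split=> //.
  apply: filterS H => x; rewrite big_enum /= => {1}->; congr (g _ + _).
  by apply/rowP => i; rewrite !mxE; congr (if _ then _ else _); exact: mem_enum.
elim=> [_|i l IH /= /andP[il /IH[T [HT H]]]].
  exists (fun _ _ => 0); split=> [_|]; first exact: analytic0_cst.
  apply: filterE => x; rewrite big_nil addr0; congr g.
  by apply/rowP => i; rewrite mxE.
have /analytic0P[r [M [r0 Hr]]] := Hg.
have [T1 [HT1 H1]] := hasSeries_hadamard1 Hs i r0 Hr.
(* The new quotient is evaluated where the coordinates of [l] already vanish, so that the
   one-variable identities telescope. *)
exists (fun j x => if j == i then T1 (zeroOn (mem l) x) else T j x); split.
  move=> j; case: eqP => // _; apply: analytic0_comp (zeroOn0 _) (analytic0_zeroOn _).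
  by apply/analytic0P; exists r, (M / r).
have H1' : \forall x \near (0 : 'rV[K]_s),
    g x = g (zeroOn (pred1 i) x) + x ord0 i * T1 x.
  by apply/near0_polydisc; exists r.
have := near0_comp (zeroOn0 (mem l)) (analytic0_zeroOn (mem l)) H1'.
move: H; apply: filterS2 => x -> ->; rewrite big_cons eqxx -!addrA; congr (g _ + (_ + _)).
- apply/rowP => j; rewrite !mxE; have -> : mem (i :: l) j = (j == i) || mem l j by [].
  by rewrite /=; case: (j == i).
- by rewrite mxE; have -> : mem l i = false by exact: negbTE.
- by apply: eq_big_seq => j jl; case: eqP => // ji; rewrite -ji jl in il.
Qed.

(** Hadamard's lemma in the second half of the variables. It serves twice: for the derivatives of
    [g], and for comparing the defect at two different points of the target. *)
Lemma analytic0_increment (s : nat) (g : 'rV[K]_s -> K) : analytic0 g ->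
  exists T : 'I_s -> 'rV[K]_(s + s) -> K, (forall i, analytic0 (T i)) /\
    \forall z \near (0 : 'rV[K]_(s + s)),
      g (lsubmx z + rsubmx z) =
      g (lsubmx z) + \sum_(i < s) rsubmx z ord0 i * T i z.
Proof.
move=> Hg; pose G (z : 'rV[K]_(s + s)) := lsubmx z + rsubmx z.
have HG : analytic0 (fun z => g (G z)).
  apply: analytic0_comp => //; first by rewrite /G !linear0 addr0.
  move=> j; apply: eq_analytic0 (analytic0D (analytic0_coord (lshift s j))
    (analytic0_coord (rshift s j))) => z.
  by rewrite /Defs.comp !mxE.
pose P (i : 'I_(s + s)) := (s <= i)%N.
have [T [HT H]] := analytic0_hadamard P HG.
exists (fun i => T (rshift s i)); split=> //; apply: filterS H => z ->.
rewrite big_mkcond big_split_ord /= big1 ?add0r; last first.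
  by move=> i _; rewrite /P /= leqNgt ltn_ord.
congr (g _ + _).
  apply/rowP => i; rewrite !mxE /P /= leq_addr leqNgt ltn_ord /= addr0 //.
by apply: eq_bigr => i _; rewrite /P /= leq_addr mxE.
Qed.

End AnalyticGerms.

(** * Derivatives of analytic germs *)

Section Differentiability.
Variable K : numFieldType.
Hypothesis Hs : summationComplete K.

Lemma coord_norm_le (s : nat) (y : 'rV[K]_s) i : `|y ord0 i| <= `|y|.
Proof.
change (`|y ord0 i| <= mx_norm y); rewrite mx_normE.
have -> : `|y ord0 i| = (`|y ord0 i|%:nng)%:num by [].
rewrite num_le.
exact: (le_bigmax _ (fun ij : 'I_1 * 'I_s => `|y ij.1 ij.2|%:nng) (ord0, i)).
Qed.

Lemma differentiable_littleo (V W : normedModType K) (f : V -> W)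
    (df : {linear V -> W}) (x : V) :
  continuous df ->
  (forall e : K, 0 < e -> \forall h \near (0 : V),
     `|f (h + x) - (f x + df h)| <= e * `|h|) ->
  differentiable f x /\ 'd f x = df :> (V -> W).
Proof.
move=> dfc H; have E : f \o shift x = cst (f x) + df +o_ 0 id by apply/eqaddoP.
have dE := diff_unique dfc E; split=> //.
by apply/diff_locallyP; rewrite dE.
Qed.

Lemma differentiable_gradient (s : nat) (g : 'rV[K]_s -> K) (x : 'rV[K]_s) (D : 'I_s -> K) :
  (forall e : K, 0 < e -> \forall h \near (0 : 'rV[K]_s),
     `|g (h + x) - (g x + \sum_(i < s) h ord0 i * D i)| <= e * `|h|) ->
  differentiable g x /\ forall v, 'd g x v = \sum_(i < s) v ord0 i * D i.
Proof.
move=> H; pose df (h : 'rV[K]_s) : K := \sum_(i < s) h ord0 i * D i.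
have df_lin : linear df.
  move=> a u v; rewrite /df scaler_sumr -big_split; apply: eq_bigr => i _ /=.
  by rewrite !mxE mulrDl -mulrA.
pose dfM := GRing.isLinear.Build _ _ _ _ _ df_lin.
pose dfL : {linear 'rV[K]_s -> K} := HB.pack df dfM.
have dfc : continuous dfL.
  move=> y; apply: differentiable_continuous.
  have -> : (dfL : _ -> _) = \sum_(i < s) (fun h : 'rV[K]_s => h ord0 i *: (D i : K)).
    by apply/funext => h; rewrite fct_sumE.
  apply: differentiable_sum => i; apply: differentiableZl; exact: differentiable_coord.
have [dg dE] := differentiable_littleo (f := g) dfc H.
by split=> // v; rewrite dE.
Qed.

Lemma analytic0_bounded (s : nat) (g : 'rV[K]_s -> K) : analytic0 g ->
  exists B : K, 0 <= B /\ \forall x \near (0 : 'rV[K]_s), `|g x| <= B.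
Proof.
move=> /(analytic0P Hs)[r [M [r0 Hg]]]; exists M; split; first exact: hasSeries_ge0 Hg.
by apply/near0_polydisc; exists r; split=> // x; exact: hasSeries_norm_le.
Qed.

Lemma near0_forall (s : nat) (I : finType) (P : I -> 'rV[K]_s -> Prop) :
  (forall i, \forall x \near (0 : 'rV[K]_s), P i x) ->
  \forall x \near (0 : 'rV[K]_s), forall i, P i x.
Proof. exact: (@filter_forall _ I P (nbhs (0 : 'rV[K]_s)) _). Qed.

Lemma polydisc_row_mx (s t : nat) (r : K) (x : 'rV[K]_s) (y : 'rV[K]_t) :
  polydisc r x -> polydisc r y -> polydisc r (row_mx x y).
Proof. by move=> xr yr i; rewrite mxE; case: splitP. Qed.

(** Hadamard's lemma is applied again, to the quotients [T i] of the increment; their values at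
    [y = 0] are the derivatives. The constant is uniform in [x], which gives differentiability at
    all points near 0 and not only at 0. *)
Lemma analytic0_taylor2 (s : nat) (g : 'rV[K]_s -> K) : analytic0 g ->
  exists D : 'I_s -> 'rV[K]_s -> K, (forall i, analytic0 (D i)) /\
  exists r C : K, [/\ 0 < r, 0 <= C & forall x y, polydisc r x -> polydisc r y ->
    `|g (x + y) - (g x + \sum_(i < s) y ord0 i * D i x)| <= C * `|y| ^+ 2].
Proof.
move=> Hg; have [T [HT H]] := analytic0_increment Hs Hg.
pose P (i : 'I_(s + s)) := (s <= i)%N.
have PE (G : 'I_(s + s) -> K) : \sum_(i | P i) G i = \sum_(i < s) G (rshift s i).
  rewrite big_mkcond big_split_ord /= big1 ?add0r; last first.
    by move=> i _; rewrite /P /= leqNgt ltn_ord.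
  by apply: eq_bigr => i _; rewrite /P /= leq_addr.
have zE (x y : 'rV[K]_s) : zeroOn P (row_mx x y) = row_mx x 0.
  apply/rowP => i; rewrite !mxE /P; case: splitP => j ij; rewrite ij.
    by rewrite leqNgt ltn_ord.
  by rewrite leq_addr mxE.
have /choice[U HU] := fun i => analytic0_hadamard Hs P (HT i).
have /choice[B HB] := fun p : 'I_s * 'I_s => analytic0_bounded ((HU p.1).1 (rshift s p.2)).
exists (fun i x => T i (row_mx x 0)); split=> [i|].
  apply: (analytic0_comp Hs (G := fun x => row_mx x 0) (HT i)) => [|j]; first by rewrite row_mx0.
  rewrite /Defs.comp; case: (split_ordP j) => k ->.
    by apply: (eq_analytic0 (g := fun x => x ord0 k)) (analytic0_coord Hs k) => x; rewrite row_mxEl.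
  by apply: (eq_analytic0 (g := fun=> 0)) (analytic0_cst Hs _ _) => x; rewrite row_mxEr mxE.
have /near0_polydisc[r [r0 Hr]] : \forall z \near (0 : 'rV[K]_(s + s)),
    [/\ g (lsubmx z + rsubmx z) = g (lsubmx z) + \sum_(i < s) rsubmx z ord0 i * T i z,
     forall i, T i z = T i (zeroOn P z) + \sum_(j | P j) z ord0 j * U i j z &
     forall p : 'I_s * 'I_s, `|U p.1 (rshift s p.2) z| <= B p].
  have H1 : \forall z \near (0 : 'rV[K]_(s + s)),
      forall i, T i z = T i (zeroOn P z) + \sum_(j | P j) z ord0 j * U i j z.
    by apply: near0_forall => i; case: (HU i).
  have H2 : \forall z \near (0 : 'rV[K]_(s + s)),
      forall p : 'I_s * 'I_s, `|U p.1 (rshift s p.2) z| <= B p.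
    by apply: near0_forall => p; case: (HB p).
  by apply: filterS3 H H1 H2.
pose C := \sum_(i < s) \sum_(j < s) B (i, j); exists r, C; split=> //.
  by apply: sumr_ge0 => i _; apply: sumr_ge0 => j _; case: (HB (i, j)).
move=> x y xr yr; have [] := Hr _ (polydisc_row_mx xr yr).
rewrite row_mxKl row_mxKr zE => -> TE UB.
rewrite opprD addrACA subrr add0r -sumrB /C mulr_suml.
apply: le_trans (ler_norm_sum _ _ _) _; apply: ler_sum => i _.
rewrite TE PE mulrDr [X in X - _]addrC addrK mulr_sumr mulr_suml.
apply: le_trans (ler_norm_sum _ _ _) _; apply: ler_sum => j _.
rewrite row_mxEr !normrM mulrA mulrC expr2 ler_pM ?mulr_ge0 ?(UB (i, j)) //.
by rewrite ler_pM ?coord_norm_le.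
Qed.

Lemma analytic0_differential (s : nat) (g : 'rV[K]_s -> K) : analytic0 g ->
  (forall i, analytic0 (pderiv g i)) /\
  \forall x \near (0 : 'rV[K]_s), differentiable g x /\
    forall v, 'd g x v = \sum_(i < s) v ord0 i * pderiv g i x.
Proof.
move=> Hg; have [D [HD [r [C [r0 C0 H]]]]] := analytic0_taylor2 Hg.
have key : \forall x \near (0 : 'rV[K]_s), differentiable g x /\
    forall v, 'd g x v = \sum_(i < s) v ord0 i * D i x.
  apply/near0_polydisc; exists r; split=> // x xr; apply: differentiable_gradient => e e0.
  (* [C] may be zero, so [C + 1] is used: for [y] of size at most [e / (C + 1)] the quadratic
     remainder is at most [e] times the norm of [y]. *)
  have C1 : 0 < C + 1 by rewrite ltr_wpDl.
  have [q [q0 qr qe]] := pos_lower_bound r0 (divr_gt0 e0 C1).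
  apply/near0_polydisc; exists q; split=> // y yq; rewrite [y + x]addrC.
  apply: le_trans (H x y xr _) _ => [i|]; first exact: le_trans (yq i) qr.
  rewrite expr2 mulrA ler_wpM2r //.
  have [y0|/mx_norm_neq0[[a b] /= yb]] := eqVneq (mx_norm y) 0.
    by have -> : `|y| = 0 by []; rewrite mulr0 ltW.
  have -> : `|y| = `|y a b| by [].
  rewrite ord1.
  apply: le_trans (_ : (C + 1) * (e / (C + 1)) <= _); last by rewrite mulrC divfK ?gt_eqF.
  by rewrite ler_pM // ?lerDl // (le_trans (yq b)).
have pE i : \forall x \near (0 : 'rV[K]_s), pderiv g i x = D i x.
  apply: filterS key => x [dg dE]; rewrite /pderiv deriveE // dE (bigD1 i) //= mxE !eqxx mul1r.
  by rewrite big1 ?addr0 // => j /negbTE ji; rewrite mxE ji andbF mul0r.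
split=> [i|].
  apply: analytic0_germ (HD i); apply: filterS (pE i) => x ->; by [].
have pE' : \forall x \near (0 : 'rV[K]_s), forall i, pderiv g i x = D i x.
  exact: near0_forall.
move: key pE'; apply: filterS2 => x [dg dE] pE'; split=> // v; rewrite dE.
by apply: eq_bigr => i _; rewrite pE'.
Qed.

End Differentiability.

(** * Euler's relation *)

Section EulerRelation.
Variable K : numFieldType.
Hypothesis Hs : summationComplete K.

Lemma near0_and (s : nat) (P Q : 'rV[K]_s -> Prop) :
  (\forall x \near (0 : 'rV[K]_s), P x) -> (\forall x \near (0 : 'rV[K]_s), Q x) ->
  \forall x \near (0 : 'rV[K]_s), P x /\ Q x.
Proof. by apply: filterS2 => x. Qed.

Lemma differentiable_row (V : normedModType K) (t : nat) (G : V -> 'rV[K]_t) (x : V) :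
  (forall j, differentiable (fun y => G y ord0 j) x) ->
  differentiable G x /\
  forall v j, 'd G x v ord0 j = 'd (fun y => G y ord0 j) x v.
Proof.
move=> dG; have dGx : differentiable G x.
  have -> : G = \sum_(j < t) (fun y => G y ord0 j *: (delta_mx ord0 j : 'rV[K]_t)).
    apply/funext => y; rewrite fct_sumE [LHS]row_sum_delta; by [].
  by apply: differentiable_sum => j; exact: differentiableZl.
split=> // v j.
rewrite -!deriveE //; apply/esym/cvg_lim; first exact: norm_hausdorff.
have dv : derivable G x v by exact: diff_derivable.
have := cvg_comp _ _ dv (@coord_continuous K 1 t ord0 j _).
by apply: cvg_trans; apply: near_eq_cvg; apply: nearW => h /=; rewrite !mxE.
Qed.

Lemma differentiable_monomial (c : K) (n : nat) :
  differentiable (fun t : K => c * t ^+ n) (1 : K) /\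
  'd (fun t : K => c * t ^+ n) (1 : K) 1 = c * n%:R.
Proof.
have dX : derivable (fun t : K => t ^+ n) (1 : K) 1 by exact: exprn_derivable.
have dcX : differentiable (fun t : K => c * t ^+ n) (1 : K).
  apply/derivable1_diffP; apply: derivableM dX; exact: derivable_cst.
split=> //; rewrite -deriveE // (deriveMl c dX) exp_derive.
by rewrite expr1n -[_ *: _]/(_ * _) -[_ *: _]/(_ * _) !mulr1.
Qed.

(** The last of [s + 1] coordinates stands for the homogeneity parameter [t], treated as one more
    analytic variable. *)
Definition scaleLast (s : nat) (k : K) (z : 'rV[K]_(s + 1)) : 'rV[K]_(s + 1) :=
  row_mx (lsubmx z) (k *: rsubmx z).

Definition lastCoord (s : nat) (z : 'rV[K]_(s + 1)) : K := z ord0 (rshift s ord0).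

Lemma zeroOn_last (s : nat) (z : 'rV[K]_(s + 1)) :
  zeroOn (pred1 (rshift s ord0)) z = scaleLast 0 z.
Proof.
apply/rowP => i; rewrite !mxE /=; case: (split_ordP i) => j ->.
  by rewrite eq_lrshift mxE.
by rewrite !ord1 eqxx !mxE mul0r.
Qed.

Lemma scaleLast_polydisc (s : nat) (r k : K) (z : 'rV[K]_(s + 1)) :
  `|k| <= 1 -> polydisc r z -> polydisc r (scaleLast k z).
Proof.
move=> k1 zr; apply: polydisc_row_mx => i; rewrite !mxE //.
by rewrite normrM; apply: le_trans (zr (rshift s i)); rewrite ler_piMl.
Qed.

Lemma scaleLastM (s : nat) (k l : K) (z : 'rV[K]_(s + 1)) :
  scaleLast k (scaleLast l z) = scaleLast (k * l) z.
Proof. by rewrite /scaleLast row_mxKl row_mxKr scalerA. Qed.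

Lemma scaleLast1 (s : nat) (z : 'rV[K]_(s + 1)) : scaleLast 1 z = z.
Proof. by rewrite /scaleLast scale1r hsubmxK. Qed.

Lemma lastCoord_scale (s : nat) (k : K) (z : 'rV[K]_(s + 1)) :
  lastCoord (scaleLast k z) = k * lastCoord z.
Proof. by rewrite /lastCoord row_mxEr !mxE. Qed.

Lemma geometric_bound_eq0 (a c : K) :
  0 <= c -> (forall N, `|a| <= 2 ^- N * c) -> a = 0.
Proof.
move=> c0 H; apply/eqP; rewrite -normr_le0; apply/ler_addgt0Pr => e e0; rewrite add0r.
have c1 : 0 < c + 1 by rewrite ltr_wpDl.
have [N HN] := expr_half_small Hs (divr_gt0 e0 c1).
apply: le_trans (H N) _; apply: le_trans (_ : e / (c + 1) * (c + 1) <= _).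
  by rewrite ler_pM ?lerDl // invr_ge0 exprn_ge0.
by rewrite divfK // gt_eqF.
Qed.

Lemma half_norm_le1 (N : nat) : `|2 ^- N : K| <= 1.
Proof.
by rewrite ger0_norm ?invr_ge0 ?exprn_ge0 // invf_le1 ?exprn_gt0 // exprn_ege1 ?ler1n.
Qed.

Lemma hadamard_last (s : nat) (Phi : 'rV[K]_(s + 1) -> K) : analytic0 Phi ->
  exists T : 'rV[K]_(s + 1) -> K, analytic0 T /\
    \forall z \near (0 : 'rV[K]_(s + 1)), Phi z = Phi (scaleLast 0 z) + lastCoord z * T z.
Proof.
move=> HPhi; have [T [HT H]] := analytic0_hadamard Hs (pred1 (rshift s ord0)) HPhi.
exists (T (rshift s ord0)); split=> //; apply: filterS H => z.
by rewrite big_pred1_eq zeroOn_last.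
Qed.

Lemma scaleLast_half_bound (s : nat) (Phi : 'rV[K]_(s + 1) -> K) : analytic0 Phi ->
  exists B : K, 0 <= B /\ \forall z \near (0 : 'rV[K]_(s + 1)), forall N,
    `|Phi (scaleLast (2 ^- N) z) - Phi (scaleLast 0 z)| <= 2 ^- N * (`|lastCoord z| * B).
Proof.
move=> /hadamard_last[T [HT H]]; have [B [B0 HB]] := analytic0_bounded Hs HT.
exists B; split=> //; have /near0_polydisc[r [r0 Hr]] := near0_and H HB.
apply/near0_polydisc; exists r; split=> // z zr N.
have [-> TB] := Hr _ (scaleLast_polydisc (half_norm_le1 N) zr).
rewrite scaleLastM mul0r [X in X - _]addrC addrK normrM lastCoord_scale normrM.
rewrite (@ger0_norm _ (2 ^- N)) ?invr_ge0 ?exprn_ge0 // -mulrA.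
by rewrite ler_wpM2l ?invr_ge0 ?exprn_ge0 // ler_wpM2l.
Qed.

Lemma scaleLast_half_iter (s d : nat) (Phi : 'rV[K]_(s + 1) -> K) :
  (\forall z \near (0 : 'rV[K]_(s + 1)), lastCoord z != 0 ->
     Phi (scaleLast 2^-1 z) = 2 ^- d * Phi z) ->
  \forall z \near (0 : 'rV[K]_(s + 1)), lastCoord z != 0 ->
     forall N, Phi (scaleLast (2 ^- N) z) = (2 ^- N) ^+ d * Phi z.
Proof.
move=> /near0_polydisc[r [r0 Hr]]; apply/near0_polydisc; exists r; split=> // z zr z0.
elim=> [|N IH]; first by rewrite expr0 invr1 scaleLast1 expr1n mul1r.
have z0N : lastCoord (scaleLast (2 ^- N) z) != 0.
  by rewrite lastCoord_scale mulf_neq0 // invr_neq0 // expf_neq0 // pnatr_eq0.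
have := Hr _ (scaleLast_polydisc (half_norm_le1 N) zr) z0N.
rewrite scaleLastM IH mulrA => h.
have e : 2 ^- N.+1 = 2^-1 * 2 ^- N :> K by rewrite exprS invfM.
by rewrite e h exprMn; congr (_ * _ * _); rewrite exprVn.
Qed.

(* Halving t repeatedly compares Phi(x, t) with Phi(x, 0); when d > 0 the latter
   vanishes and Hadamard's lemma lets one divide by t. *)
Lemma homogeneous_last (s d : nat) (Phi : 'rV[K]_(s + 1) -> K) :
  analytic0 Phi ->
  (\forall z \near (0 : 'rV[K]_(s + 1)), lastCoord z != 0 ->
     Phi (scaleLast 2^-1 z) = 2 ^- d * Phi z) ->
  exists C : 'rV[K]_s -> K, \forall z \near (0 : 'rV[K]_(s + 1)),
    lastCoord z != 0 -> Phi z = lastCoord z ^+ d * C (lsubmx z).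
Proof.
elim: d Phi => [|d IH] Phi HPhi Hhom.
  have [B [B0 HB]] := scaleLast_half_bound HPhi.
  exists (fun x => Phi (row_mx x 0)).
  move: HB (scaleLast_half_iter Hhom); apply: filterS2 => z HB Hit z0.
  apply/eqP; rewrite expr0 mul1r -subr_eq0; apply/eqP.
  apply: (@geometric_bound_eq0 _ (`|lastCoord z| * B)) => [|N]; first by rewrite mulr_ge0.
  by have := HB N; rewrite Hit // expr0 mul1r /scaleLast scale0r.
have [B [B0 HB]] := scaleLast_half_bound HPhi.
have Phi0 : \forall z \near (0 : 'rV[K]_(s + 1)),
    lastCoord z != 0 -> Phi (scaleLast 0 z) = 0.
  move: HB (scaleLast_half_iter Hhom); apply: filterS2 => z HB Hit z0.
  apply: (@geometric_bound_eq0 _ (`|lastCoord z| * B + `|Phi z|)) => [|N].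
    by rewrite addr_ge0 // mulr_ge0.
  have := HB N; rewrite Hit // => h; rewrite mulrDr.
  rewrite -[Phi (scaleLast 0 z)](subrK ((2 ^- N) ^+ d.+1 * Phi z)).
  rewrite (le_trans (ler_normD _ _)) // lerD //; first by rewrite distrC.
  rewrite normrM ler_wpM2r // exprS normrM (@ger0_norm _ (2 ^- N)) ?invr_ge0 ?exprn_ge0 //.
  by rewrite ler_piMr ?invr_ge0 ?exprn_ge0 // normrX exprn_ile1 ?half_norm_le1.
have [T [HT H]] := hadamard_last HPhi.
have Thom : \forall z \near (0 : 'rV[K]_(s + 1)), lastCoord z != 0 ->
    T (scaleLast 2^-1 z) = 2 ^- d * T z.
  have /near0_polydisc[r [r0 Hr]] := near0_and (near0_and H Phi0) Hhom.
  apply/near0_polydisc; exists r; split=> // z zr z0.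
  have half1 : `|2^-1 : K| <= 1 by have := half_norm_le1 1; rewrite expr1.
  have [[HTz Hz0] hom] := Hr _ zr; have [[HTh _] _] := Hr _ (scaleLast_polydisc half1 zr).
  have := hom z0; rewrite HTz HTh scaleLastM mul0r Hz0 // !add0r lastCoord_scale.
  (* One factor [2^-1] and the nonzero last coordinate cancel, which lowers the degree by one. *)
  rewrite exprS invfM -!mulrA => /(mulfI _); rewrite invr_eq0 pnatr_eq0 => /(_ isT).
  by rewrite mulrCA => /(mulfI z0).
have [C HC] := IH T HT Thom; exists C.
move: (near0_and H Phi0) HC; apply: filterS2 => z [-> Hz0] HC z0.
by rewrite Hz0 // add0r HC // exprS mulrA.
Qed.

(** Homogeneity holds for each [t] only on a neighbourhood depending on [t], so it cannot be
    differentiated in [t] directly. Instead [g(t^w x)] is an analytic germ in [(x, t)], and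
    homogeneity for the single value [t = 1/2] forces it to be [t^d C(x)] for all small nonzero [t].
    Homogeneity for one fixed [t0] then carries this to [t] near 1, where the chain rule applies. *)
Lemma euler_relation (s d : nat) (w : 'I_s -> nat) (g : 'rV[K]_s -> K) :
  analytic0 g ->
  (forall t : K, germ_eq (fun x => g (wscale w t x)) (fun x => t ^+ d * g x)) ->
  \forall x \near (0 : 'rV[K]_s),
    d%:R * g x = \sum_(i < s) (w i)%:R * x ord0 i * pderiv g i x.
Proof.
move=> Hg Hhom.
pose G (z : 'rV[K]_(s + 1)) := wscale w (lastCoord z) (lsubmx z).
have G0 : G 0 = 0.
  by apply/rowP => i; rewrite !mxE mulr0.
have HG j : analytic0 (Defs.comp G j).
  (* The [j]-th component of [G] is the monomial [t^(w_j) x_j]. *)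
  pose a (i : 'I_(s + 1)) := match fintype.split i with inl k => (k == j : nat) | inr _ => w j end.
  apply: eq_analytic0 (analytic0_monom Hs a) => z; rewrite /Defs.comp !mxE.
  rewrite /monom big_split_ord /= big_ord1 mulrC /a; congr (_ * _).
    by rewrite (unsplitK (inr _)).
  rewrite (bigD1 j) //= (unsplitK (inl _)) eqxx expr1 big1 ?mulr1 // => k /negbTE kj.
  by rewrite (unsplitK (inl _)) kj expr0.
have HPhi : analytic0 (fun z => g (G z)) by exact: analytic0_comp.
have GE k z : G (scaleLast k z) = wscale w k (G z).
  apply/rowP => i; rewrite [LHS]mxE lastCoord_scale /scaleLast row_mxKl !mxE exprMn.
  by rewrite mulrA.
have [|C /near0_polydisc[r [r0 HC]]] := homogeneous_last (d := d) HPhi.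
  have := near0_comp Hs G0 HG (Hhom 2^-1); apply: filterS => z h _.
  by rewrite GE h exprVn.
(* With [t0 = r / 2], the product [t0 * t] stays within radius [r] for all [t] of size at most 2. *)
have [t0 [t00 t0E]] : exists t0 : K, 0 < t0 /\ t0 * 2 = r.
  by exists (r / 2); rewrite divfK ?pnatr_eq0 // divr_gt0.
have /near0_polydisc[q [q0 Hq]] := Hhom t0.
(* [W] dominates every weight, so for [t] of size at most 2 scaling enlarges each coordinate by at
   most [2 ^+ W]. *)
pose W := (\sum_(i < s) w i)%N.
have wW i : (w i <= W)%N by rewrite /W (bigD1 i) //= leq_addr.
have q20 : 0 < q / 2 ^+ W by rewrite divr_gt0 // exprn_gt0.
have [u [u0 uq ur]] := pos_lower_bound q20 r0.
have homC x t : polydisc u x -> t != 0 -> `|t| <= 2 -> g (wscale w t x) = t ^+ d * C x.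
  move=> xu tn0 t2.
  have txq : polydisc q (wscale w t x).
    move=> i; rewrite mxE normrM normrX.
    apply: le_trans (_ : 2 ^+ W * (q / 2 ^+ W) <= q); last first.
      by rewrite mulrC divfK // expf_neq0 // pnatr_eq0.
    rewrite ler_pM ?exprn_ge0 // ?(le_trans (xu i)) //.
    apply: le_trans (_ : 2 ^+ w i <= _); last by rewrite ler_weXn2l ?ler1n.
    by rewrite lerXn2r ?nnegrE.
  have /= := Hq _ txq; pose z : 'rV[K]_(s + 1) := row_mx x ((t0 * t)%:M).
  have zl : lastCoord z = t0 * t by rewrite /lastCoord row_mxEr mxE eqxx mulr1n.
  have zr : polydisc r z.
    apply: polydisc_row_mx => i; first exact: le_trans (xu i) ur.
    rewrite !ord1 mxE eqxx mulr1n normrM gtr0_norm //.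
    by apply: le_trans (_ : t0 * 2 <= _); rewrite ?ler_pM2l // t0E.
  have zn0 : lastCoord z != 0 by rewrite zl mulf_neq0 // gt_eqF.
  have := HC z zr zn0; rewrite /G zl /z row_mxKl.
  have -> : wscale w (t0 * t) x = wscale w t0 (wscale w t x).
    by apply/rowP => i; rewrite !mxE exprMn mulrA.
  have t0d : t0 ^+ d != 0 by rewrite expf_neq0 // gt_eqF.
  by move=> -> /esym; rewrite exprMn -mulrA => /(mulfI t0d).
have [_ Hdiff] := analytic0_differential Hs Hg.
have Hu : \forall x \near (0 : 'rV[K]_s), polydisc u x by apply/near0_polydisc; exists u.
move: Hdiff Hu; apply: filterS2 => x [dg dgE] xu.
have gC : g x = C x.
  rewrite -[RHS]mul1r -(expr1n _ d) -homC ?oner_neq0 ?normr1 ?ler1n //.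
  by congr g; apply/rowP => i; rewrite mxE expr1n mul1r.
pose gam (t : K) := wscale w t x.
have gam1 : gam 1 = x by apply/rowP => i; rewrite mxE expr1n mul1r.
have gamE j : (fun t : K => gam t ord0 j) = (fun t : K => x ord0 j * t ^+ w j).
  by apply/funext => t; rewrite mxE mulrC.
have [dgam dgamE] : differentiable gam (1 : K) /\
    forall v j, 'd gam (1 : K) v ord0 j = 'd (fun t : K => gam t ord0 j) (1 : K) v.
  by apply: differentiable_row => j; rewrite gamE; case: (differentiable_monomial (x ord0 j) (w j)).
have dg1 : differentiable g (gam 1) by rewrite gam1.
have E : 'D_1 (g \o gam) (1 : K) = 'D_1 (fun t : K => g x * t ^+ d) (1 : K).
  (* The open ball of radius 1 about 1 avoids 0 and stays inside [|t| <= 2]. *)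
  apply: near_eq_derive; apply/nbhs_ballP; exists 1 => //= t; rewrite /ball /= => t1.
  rewrite homC //; first by rewrite mulrC gC.
    by apply/eqP => t00'; move: t1; rewrite t00' subr0 normr1 ltxx.
  rewrite -[t](subrK 1) (le_trans (ler_normD _ _)) // normr1 (_ : (2 : K) = 1 + 1) //.
  by rewrite lerD2r distrC ltW.
have d1 : differentiable (g \o gam) (1 : K) by exact: differentiable_comp.
have [d2 d2E] := differentiable_monomial (g x) d.
move: E; rewrite (deriveE _ d1) (deriveE _ d2) d2E diff_comp //= gam1 dgE [g x * _]mulrC => <-.
apply: eq_bigr => i _; rewrite dgamE gamE (differentiable_monomial (x ord0 i) (w i)).2.
by rewrite [x ord0 i * _]mulrC.
Qed.

End EulerRelation.

(** * Lifting the Euler field *)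

Section DirectionalDerivatives.
Variable K : numFieldType.

(** Differentiability and the value of the derivative travel together, so the rules below compose
    without separate side conditions. *)
Definition hasDir (s : nat) (g : 'rV[K]_s -> K) (z v : 'rV[K]_s) (l : K) : Prop :=
  differentiable g z /\ 'd g z v = l.

Lemma diff_pderiv (s : nat) (g : 'rV[K]_s -> K) (z v : 'rV[K]_s) :
  differentiable g z -> 'd g z v = \sum_(i < s) v ord0 i * pderiv g i z.
Proof.
move=> dg; rewrite {1}(row_sum_delta v) linear_sum; apply: eq_bigr => i _.
by rewrite linearZ /pderiv deriveE.
Qed.

Lemma hasDir_dmap (s t : nat) (G : 'rV[K]_s -> 'rV[K]_t) (xi : 'I_s -> 'rV[K]_s -> K) j z l :
  hasDir (Defs.comp G j) z (\row_i xi i z) l -> dmap G xi j z = l.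
Proof.
case=> dg <-; rewrite diff_pderiv //; apply: eq_bigr => i _; by rewrite mxE.
Qed.

Lemma hasDir_cst (s : nat) (k : K) (z v : 'rV[K]_s) : hasDir (fun=> k) z v 0.
Proof. by split; [exact: differentiable_cst|rewrite (diff_cst (V := 'rV[K]_s) (W := K))]. Qed.

Lemma hasDir_coord (s : nat) i (z v : 'rV[K]_s) :
  hasDir (fun x : 'rV[K]_s => x ord0 i) z v (v ord0 i).
Proof.
have dc : differentiable (fun x : 'rV[K]_s => x ord0 i : K) z by exact: differentiable_coord.
split=> //.
have [dI dIE] := @differentiable_row K 'rV[K]_s s id z (fun j => differentiable_coord z ord0 j).
rewrite -dIE; congr (fun_of_matrix _ _ _).
by rewrite diff_val.
Qed.

Lemma hasDirD (s : nat) (g h : 'rV[K]_s -> K) (z v : 'rV[K]_s) a b :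
  hasDir g z v a -> hasDir h z v b -> hasDir (fun x => g x + h x) z v (a + b).
Proof.
move=> [dg <-] [dh <-]; have -> : (fun x => g x + h x) = g + h by [].
by split; [exact: differentiableD|rewrite diffD].
Qed.

Lemma hasDirM (s : nat) (g h : 'rV[K]_s -> K) (z v : 'rV[K]_s) a b :
  hasDir g z v a -> hasDir h z v b -> hasDir (fun x => g x * h x) z v (a * h z + g z * b).
Proof.
move=> [dg <-] [dh <-]; have -> : (fun x => g x * h x) = g * h by [].
split; first exact: differentiableM.
by rewrite diffM // -[LHS]/(g z * 'd h z v + h z * 'd g z v) addrC [h z * _]mulrC.
Qed.

Lemma hasDir_sum (s : nat) (I : Type) (l : seq I) (g : I -> 'rV[K]_s -> K)
    (z v : 'rV[K]_s) (a : I -> K) :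
  (forall i, hasDir (g i) z v (a i)) ->
  hasDir (fun x => \sum_(i <- l) g i x) z v (\sum_(i <- l) a i).
Proof.
move=> H; elim: l => [|i l IH].
  rewrite big_nil (_ : (fun x => _) = fun=> 0); first exact: hasDir_cst.
  by apply/funext => x; rewrite big_nil.
rewrite big_cons (_ : (fun x => _) = fun x => g i x + \sum_(i <- l) g i x).
  exact: hasDirD.
by apply/funext => x; rewrite big_cons.
Qed.

Lemma hasDir_comp (s t : nat) (G : 'rV[K]_s -> 'rV[K]_t) (q : 'rV[K]_t -> K)
    (z v : 'rV[K]_s) (u : 'rV[K]_t) (l : K) :
  (forall j, hasDir (Defs.comp G j) z v (u ord0 j)) -> hasDir q (G z) u l ->
  hasDir (fun x => q (G x)) z v l.
Proof.
move=> HG [dq <-].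
have [dG dGE] := differentiable_row (fun j => (HG j).1).
have -> : (fun x => q (G x)) = q \o G by [].
split; first exact: differentiable_comp.
rewrite diff_comp //=; congr ('d q _ _); apply/rowP => j.
by rewrite dGE; exact: (HG j).2.
Qed.

End DirectionalDerivatives.

(** * The Euler field of the unfolding and its correction *)

Section Substantial.
Variable K : numFieldType.
Hypothesis Hs : summationComplete K.
Variables (n p m : nat) (f : 'rV[K]_n -> 'rV[K]_p).
Variables (w : 'I_n -> nat) (d : 'I_p -> nat).
Variables (alpha : 'I_m -> 'I_n -> nat) (jk : 'I_m -> 'I_p).
Variable q : 'I_m -> 'I_m -> 'rV[K]_(p + m) -> K.
Hypothesis f_analytic : forall j, analytic0 (Defs.comp f j).
Hypothesis f0 : f 0 = 0.
Hypothesis f_homogeneous : forall (t : K) (j : 'I_p),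
  germ_eq (fun x => Defs.comp f j (wscale w t x)) (fun x => t ^+ d j * Defs.comp f j x).
Hypothesis q_analytic : forall k s, analytic0 (q k s).
Hypothesis q0 : forall k s, q k s 0 = 0.

Let F := unfoldingF f alpha jk q.
Let Wd k := (\sum_(i < n) w i * alpha k i)%N.

(* The weight d_{j_k} - d_{p+k} that makes lambda_k * fbar^k homogeneous of degree d_{j_k}. *)
Definition unfoldingWeight (k : 'I_m) : K := (d (jk k))%:R - (Wd k)%:R.
Let e := unfoldingWeight.

Definition sourceWeight (i : 'I_(n + m)) : K :=
  match fintype.split i with inl i => (w i)%:R | inr k => e k end.

Definition targetWeight (i : 'I_(p + m)) : K :=
  match fintype.split i with inl j => (d j)%:R | inr k => e k end.

(** The map through which the [q k s] enter [F]. It intertwines the two Euler fields exactly, unlike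
    [F]. *)
Definition trivialUnfolding (z : 'rV[K]_(n + m)) : 'rV[K]_(p + m) :=
  row_mx (f (lsubmx z)) (rsubmx z).
Let g := trivialUnfolding.

Let fb k j (z : 'rV[K]_(n + m)) : K := fbar alpha jk k j (lsubmx z).

(** The coefficient of the [k]-th monomial field in [F]. *)
Let c k (z : 'rV[K]_(n + m)) : K := z ord0 (rshift n k) + \sum_(s < m) z ord0 (rshift n s) * q k s (g z).

Definition euler_target (h : 'rV[K]_(p + m) -> K) (Y : 'rV[K]_(p + m)) : K :=
  \sum_i (targetWeight i * Y ord0 i) * pderiv h i Y.

(* By Euler's relation, the Euler field applied to F misses being d_j F_j by
   sum_s lambda_s sum_k (H_ks o g) fbar^k. *)
Definition defect k s (Y : 'rV[K]_(p + m)) : K :=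
  (e s - e k) * q k s Y + euler_target (q k s) Y.

Let sourceE_l i : sourceWeight (lshift m i) = (w i)%:R.
Proof. by rewrite /sourceWeight (unsplitK (inl _)). Qed.
Let sourceE_r k : sourceWeight (rshift n k) = e k.
Proof. by rewrite /sourceWeight (unsplitK (inr _)). Qed.
Let targetE_l j : targetWeight (lshift m j) = (d j)%:R.
Proof. by rewrite /targetWeight (unsplitK (inl _)). Qed.
Let targetE_r k : targetWeight (rshift p k) = e k.
Proof. by rewrite /targetWeight (unsplitK (inr _)). Qed.

Lemma analytic0_lsubmx j : analytic0 (Defs.comp (@lsubmx K 1 n m) j).
Proof.
by apply: eq_analytic0 (analytic0_coord Hs (lshift m j)) => z; rewrite /Defs.comp mxE.
Qed.

Lemma lsubmx_at0 : lsubmx (0 : 'rV[K]_(n + m)) = 0.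
Proof. exact: linear0. Qed.

Lemma trivialUnfolding0 : g 0 = 0.
Proof. by rewrite /g /trivialUnfolding !linear0 f0 row_mx0. Qed.

Lemma comp_g_l j z : Defs.comp g (lshift m j) z = Defs.comp f j (lsubmx z).
Proof. by rewrite /Defs.comp row_mxEl. Qed.

Lemma comp_g_r k z : Defs.comp g (rshift p k) z = z ord0 (rshift n k).
Proof. by rewrite /Defs.comp row_mxEr mxE. Qed.

Lemma trivialUnfolding_analytic j : analytic0 (Defs.comp g j).
Proof.
case: (split_ordP j) => i ->.
  apply: eq_analytic0 (analytic0_comp Hs (f_analytic i) lsubmx_at0 analytic0_lsubmx) => z.
  by rewrite comp_g_l.
by apply: eq_analytic0 (analytic0_coord Hs (rshift n i)) => z; rewrite comp_g_r.
Qed.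

Lemma fb_analytic k j : analytic0 (fb k j).
Proof.
rewrite /fb /fbar; case: (j == jk k); last exact: analytic0_cst.
exact: (analytic0_comp Hs (analytic0_monom Hs (alpha k)) lsubmx_at0 analytic0_lsubmx).
Qed.

Lemma q_g_analytic k s : analytic0 (fun z => q k s (g z)).
Proof. exact: (analytic0_comp Hs (q_analytic k s) trivialUnfolding0 trivialUnfolding_analytic). Qed.

Lemma c_analytic k : analytic0 (c k).
Proof.
apply: analytic0D; first exact: Hs; first exact: analytic0_coord.
apply: analytic0_sum => // s; apply: analytic0M => //; first exact: analytic0_coord.
exact: q_g_analytic.
Qed.

Lemma comp_F_l j z : Defs.comp F (lshift m j) z =
  Defs.comp f j (lsubmx z) + \sum_(k < m) c k z * fb k j z.
Proof.
rewrite /Defs.comp /F /unfoldingF row_mxEl mxE; congr (_ + _).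
rewrite summxE; apply: eq_bigr => k _; rewrite !mxE; congr ((_ + _) * _).
by apply: eq_bigr => s _; rewrite mxE.
Qed.

Lemma comp_F_r k z : Defs.comp F (rshift p k) z = z ord0 (rshift n k).
Proof. by rewrite /Defs.comp /F /unfoldingF row_mxEr mxE. Qed.

Lemma F_analytic j : analytic0 (Defs.comp F j).
Proof.
case: (split_ordP j) => i ->.
  apply: (eq_analytic0 (g := fun z => Defs.comp f i (lsubmx z) + \sum_(k < m) c k z * fb k i z)).
    by move=> z; rewrite comp_F_l.
  apply: analytic0D => //.
    exact: (analytic0_comp Hs (f_analytic i) lsubmx_at0 analytic0_lsubmx).
  apply: analytic0_sum => // k; apply: analytic0M => //; [exact: c_analytic|exact: fb_analytic].
by apply: eq_analytic0 (analytic0_coord Hs (rshift n i)) => z; rewrite comp_F_r.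
Qed.

Lemma c0 k : c k 0 = 0.
Proof. by rewrite /c mxE big1 ?addr0 // => s _; rewrite mxE mul0r. Qed.

Lemma F0 : F 0 = 0.
Proof.
apply/rowP => j; rewrite [RHS]mxE; case: (split_ordP j) => i ->.
  rewrite -[LHS]/(Defs.comp F _ 0) comp_F_l lsubmx_at0 /Defs.comp f0 mxE big1 ?addr0 // => k _.
  by rewrite c0 mul0r.
by rewrite -[LHS]/(Defs.comp F _ 0) comp_F_r mxE.
Qed.

Lemma defect_analytic k s : analytic0 (defect k s).
Proof.
apply: analytic0D => //; first by apply: analytic0M => //; exact: analytic0_cst.
apply: analytic0_sum => // i; apply: analytic0M => //.
  by apply: analytic0M => //; [exact: analytic0_cst|exact: analytic0_coord].
by have [] := analytic0_differential Hs (q_analytic k s).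
Qed.

Lemma defect0 k s : defect k s 0 = 0.
Proof.
by rewrite /defect q0 mulr0 add0r /euler_target big1 // => i _; rewrite mxE mulr0 mul0r.
Qed.

Let v (z : 'rV[K]_(n + m)) : 'rV[K]_(n + m) := \row_i (sourceWeight i * z ord0 i).

Lemma euler_hasDir (h : 'rV[K]_n -> K) (dh : nat) :
  analytic0 h ->
  (forall t : K, germ_eq (fun x => h (wscale w t x)) (fun x => t ^+ dh * h x)) ->
  \forall z \near (0 : 'rV[K]_(n + m)),
    hasDir (fun z => h (lsubmx z)) z (v z) (dh%:R * h (lsubmx z)).
Proof.
move=> ha hh; have E := euler_relation Hs ha hh; have [_ D] := analytic0_differential Hs ha.
move: (near0_comp Hs lsubmx_at0 analytic0_lsubmx E)
  (near0_comp Hs lsubmx_at0 analytic0_lsubmx D); apply: filterS2 => z -> [dh' dE].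
apply: (hasDir_comp (u := lsubmx (v z))).
  move=> j; rewrite mxE (_ : Defs.comp _ j = fun x => x ord0 (lshift m j)).
    exact: hasDir_coord.
  by apply/funext => x; rewrite /Defs.comp mxE.
split=> //; rewrite dE; apply: eq_bigr => i _.
by rewrite !mxE sourceE_l.
Qed.

Lemma monom_wscale (a : 'I_n -> nat) (t : K) (x : 'rV[K]_n) :
  monom a (wscale w t x) = t ^+ (\sum_(i < n) w i * a i)%N * monom a x.
Proof.
rewrite /monom -prodrXr -big_split; apply: eq_bigr => i _ /=.
by rewrite mxE exprMn exprM.
Qed.

(** The weights [e k] give [lambda_k] times the [k]-th monomial the degree of component [jk k], so
    [f] and these linear terms cancel; only the [q k s] contribute, through their failure to be
    homogeneous of degree [e k - e s]. *)
Lemma euler_F :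
  \forall z \near (0 : 'rV[K]_(n + m)), forall i,
    dmap F (fun i (z : 'rV[K]_(n + m)) => sourceWeight i * z ord0 i) i z =
    targetWeight i * Defs.comp F i z +
    \sum_(s < m) z ord0 (rshift n s) * \sum_(k < m) defect k s (g z) *
      match fintype.split i with inl j => fb k j z | inr _ => 0 end.
Proof.
have Hf : \forall z \near (0 : 'rV[K]_(n + m)), forall j,
    hasDir (fun z => Defs.comp f j (lsubmx z)) z (v z) ((d j)%:R * Defs.comp f j (lsubmx z)).
  by apply: near0_forall => j; exact: euler_hasDir.
have Hm : \forall z \near (0 : 'rV[K]_(n + m)), forall k,
    hasDir (fun z => monom (alpha k) (lsubmx z)) z (v z)
      ((Wd k)%:R * monom (alpha k) (lsubmx z)).
  apply: near0_forall => k; apply: euler_hasDir; first exact: analytic0_monom.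
  by move=> t; apply: filterE => x; exact: monom_wscale.
have Hq : \forall z \near (0 : 'rV[K]_(n + m)), forall ks : 'I_m * 'I_m,
    differentiable (q ks.1 ks.2) (g z).
  apply: near0_forall => -[k s] /=.
  have [_ D] := analytic0_differential Hs (q_analytic k s).
  by apply: filterS (near0_comp Hs trivialUnfolding0 trivialUnfolding_analytic D) => z [].
move: Hf Hm Hq; apply: filterS3 => z Hf Hm Hq i.
apply: hasDir_dmap; rewrite -/(v z).
have Hl k : hasDir (fun z : 'rV[K]_(n + m) => z ord0 (rshift n k)) z (v z)
    (e k * z ord0 (rshift n k)).
  by rewrite -(sourceE_r k); have := hasDir_coord (rshift n k) z (v z); rewrite mxE.
(* Each component of [g] is an eigenfunction of the source Euler field with eigenvalue
   [targetWeight], so differentiating [q k s o g] amounts to differentiating [q k s] along the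
   target Euler field. *)
have Hqg k s : hasDir (fun z => q k s (g z)) z (v z) (euler_target (q k s) (g z)).
  apply: (hasDir_comp (u := \row_i (targetWeight i * g z ord0 i))).
    move=> j; rewrite mxE -[g z ord0 j]/(Defs.comp g j z); case: (split_ordP j) => a ->.
      by rewrite targetE_l comp_g_l (funext (comp_g_l a)).
    by rewrite targetE_r comp_g_r (funext (comp_g_r a)).
  split; first exact: (Hq (k, s)).
  rewrite diff_pderiv; last exact: (Hq (k, s)).
  by apply: eq_bigr => a _; rewrite mxE.
have Hc k := hasDirD (Hl k) (hasDir_sum (index_enum 'I_m) (fun s => hasDirM (Hl s) (Hqg k s))).
have Hfb k j : hasDir (fb k j) z (v z) ((Wd k)%:R * fb k j z).
  rewrite /fb /fbar; case: (j == jk k); first exact: Hm.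
  by rewrite mulr0; exact: hasDir_cst.
case: (split_ordP i) => a ->; last first.
  rewrite targetE_r comp_F_r big1 ?addr0.
    by rewrite (funext (comp_F_r a)).
  by move=> s _; rewrite big1 ?mulr0 // => k _; rewrite mulr0.
rewrite targetE_l comp_F_l (funext (comp_F_l a)).
have := hasDirD (Hf a) (hasDir_sum (index_enum 'I_m) (fun k => hasDirM (Hc k) (Hfb k a))).
rewrite -/c; congr hasDir; rewrite mulrDr -addrA; congr (_ + _).
under [X in _ = _ + X]eq_bigr do rewrite mulr_sumr.
rewrite exchange_big mulr_sumr -big_split; apply: eq_bigr => k _ /=.
(* The [k]-th monomial field vanishes outside component [jk k], where [d] equals [e k + Wd k]. *)
have ek : (d a)%:R * (c k z * fb k a z) = (e k + (Wd k)%:R) * (c k z * fb k a z).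
  rewrite /fb /fbar; case: eqP => [->|]; last by rewrite !mulr0.
  by rewrite /e /unfoldingWeight subrK.
have key : \sum_(s < m) z ord0 (rshift n s) * (defect k s (g z) * fb k a z) =
    fb k a z * (\sum_(s < m) (e s * z ord0 (rshift n s) * q k s (g z) +
      z ord0 (rshift n s) * euler_target (q k s) (g z)) -
      e k * \sum_(s < m) z ord0 (rshift n s) * q k s (g z)).
  rewrite mulr_sumr -sumrB mulr_sumr; apply: eq_bigr => s _.
  by rewrite /defect; ring.
by rewrite ek key /c; ring.
Qed.

(** [F] and [g] have the same [Lambda]-components and agree for [lambda = 0], so [F - g] has entries
    in the ideal of the [lambda_r]; the increment formula then puts the difference of the defects in
    that ideal. *)
Lemma defect_split :
  exists A : 'I_m -> 'I_m -> 'I_m -> 'rV[K]_(n + m) -> K,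
    (forall k s r, analytic0 (A k s r)) /\
    \forall z \near (0 : 'rV[K]_(n + m)), forall ks : 'I_m * 'I_m,
      defect ks.1 ks.2 (g z) =
      defect ks.1 ks.2 (F z) - \sum_(r < m) z ord0 (rshift n r) * A ks.1 ks.2 r z.
Proof.
have /choice[T HT] := fun ks : 'I_m * 'I_m =>
  analytic0_increment Hs (defect_analytic ks.1 ks.2).
pose G z := row_mx (g z) (F z - g z).
have G0 : G 0 = 0 by rewrite /G trivialUnfolding0 F0 subr0 row_mx0.
have HG j : analytic0 (Defs.comp G j).
  case: (split_ordP j) => i ->.
    by apply: eq_analytic0 (trivialUnfolding_analytic i) => z; rewrite /Defs.comp row_mxEl.
  apply: eq_analytic0 (analytic0B Hs (F_analytic i) (trivialUnfolding_analytic i)) => z.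
  by rewrite /Defs.comp row_mxEr !mxE.
(* The coefficient of [lambda_r] in the [j]-th entry of [F - g]; the Kronecker symbol comes from the
   linear term [lambda_k]. *)
pose psi r j z := \sum_(k < m) ((k == r)%:R + q k r (g z)) * fb k j z.
have psi_analytic r j : analytic0 (psi r j).
  apply: analytic0_sum => // k; apply: analytic0M => //; last exact: fb_analytic.
  by apply: analytic0D => //; [exact: analytic0_cst|exact: q_g_analytic].
have FgE j z : (F z - g z) ord0 (lshift m j) = \sum_(r < m) z ord0 (rshift n r) * psi r j z.
  rewrite mxE [X in _ + X]mxE -[F z _ _]/(Defs.comp F _ z) -[g z _ _]/(Defs.comp g _ z).
  rewrite comp_F_l comp_g_l addrC addKr.
  under [RHS]eq_bigr do rewrite mulr_sumr.
  rewrite exchange_big; apply: eq_bigr => k _ /=.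
  under eq_bigr do rewrite mulrA mulrDr.
  rewrite -mulr_suml big_split /=; congr ((_ + _) * _).
  rewrite (bigD1 k) //= eqxx mulr1 big1 ?addr0 // => r /negbTE rk.
  by rewrite eq_sym rk mulr0.
exists (fun k s r z => \sum_(j < p) psi r j z * T (k, s) (lshift m j) (G z)); split.
  move=> k s r; apply: analytic0_sum => // j; apply: analytic0M => //.
  by apply: (analytic0_comp Hs) G0 HG; have [] := HT (k, s).
apply: near0_forall => -[k s] /=; have [_ H] := HT (k, s).
apply: filterS (near0_comp Hs G0 HG H) => z.
rewrite /G row_mxKl row_mxKr addrC subrK big_split_ord /= [X in _ + (_ + X)]big1; last first.
  move=> i _; rewrite mxE [X in _ + X]mxE -[F z _ _]/(Defs.comp F _ z) -[g z _ _]/(Defs.comp g _ z).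
  by rewrite comp_F_r comp_g_r subrr mul0r.
move=> ->; rewrite addr0; set S1 := \sum_(i < p) _; set S2 := \sum_(r < m) _.
suff -> : S2 = S1 by rewrite addrK.
rewrite /S2; under eq_bigr do rewrite mulr_sumr.
rewrite exchange_big; apply: eq_bigr => j _ /=.
by rewrite FgE mulr_suml; apply: eq_bigr => r _; rewrite mulrA.
Qed.

Theorem unfolding_substantial :
  (forall k, e k != 0) -> stable F -> substantial F.
Proof.
move=> e0 Fstable; have [A [HA HAE]] := defect_split.
(* The [k]-th monomial field as a field along [F], with zero [Lambda]-components. *)
pose zeta1 k (i : 'I_(p + m)) (z : 'rV[K]_(n + m)) : K :=
  match fintype.split i with inl j => fb k j z | inr _ => 0 end.
have zeta1_analytic k : vfield (zeta1 k).
  move=> i; rewrite /zeta1; case: (fintype.split i) => [j|_]; first exact: fb_analytic.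
  exact: analytic0_cst.
(* The coefficients [A] are functions of the source and need not factor through [F], so they are
   absorbed into the field before stability is used. *)
pose zeta2 (sr : 'I_m * 'I_m) (i : 'I_(p + m)) (z : 'rV[K]_(n + m)) : K :=
  \sum_(k < m) A k sr.1 sr.2 z * zeta1 k i z.
have zeta2_analytic sr : vfield (zeta2 sr).
  by move=> i; apply: analytic0_sum => // k; apply: analytic0M => //; exact: zeta1_analytic.
have /choice[xi1 /choice[eta1 H1]] := fun k => Fstable _ (zeta1_analytic k).
have /choice[xi2 /choice[eta2 H2]] := fun sr => Fstable _ (zeta2_analytic sr).
pose lam s (z : 'rV[K]_(n + m)) := z ord0 (rshift n s).
(* The part of the correction left after one [Lambda_s] is taken out. It vanishes at 0 because
   [defect] and the remaining [Lambda_r] do, which places the total in [m_Lambda m_{p+m}]. *)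
pose a (i : 'I_(p + m)) s (Y : 'rV[K]_(p + m)) :=
  \sum_(k < m) defect k s Y * eta1 k i Y - \sum_(r < m) Lam r Y * eta2 (s, r) i Y.
have a_analytic i s : analytic0 (a i s).
  apply: analytic0B => //; apply: analytic0_sum => // k; apply: analytic0M => //.
  - exact: defect_analytic.
  - by have [_ []] := H1 k.
  - exact: analytic0_coord.
  - by have [_ []] := H2 (s, k).
pose eta (i : 'I_(p + m)) (Y : 'rV[K]_(p + m)) : K :=
  targetWeight i * Y ord0 i + \sum_(s < m) Lam s Y * a i s Y.
pose xi (i : 'I_(n + m)) (z : 'rV[K]_(n + m)) : K :=
  sourceWeight i * z ord0 i - \sum_(s < m) lam s z *
    (\sum_(k < m) defect k s (F z) * xi1 k i z - \sum_(r < m) lam r z * xi2 (s, r) i z).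
exists eta; split; last first.
  (* The unit is the constant [e k]: no correction term has to be absorbed into it. *)
  move=> k; exists (fun=> e k), (a (rshift p k)); split; first exact: analytic0_cst.
  split=> //; split.
    move=> l; split; first exact: a_analytic.
    rewrite /a big1 => [|i _]; last by rewrite defect0 mul0r.
    by rewrite big1 ?subr0 // => i _; rewrite /Lam mxE mul0r.
  by apply: filterE => Y; rewrite /eta targetE_r mulrC.
split.
  move=> i; apply: analytic0D => //.
    by apply: analytic0M => //; [exact: analytic0_cst|exact: analytic0_coord].
  by apply: analytic0_sum => // s; apply: analytic0M => //; exact: analytic0_coord.
exists xi; split.
  move=> i; apply: analytic0B => //.
    by apply: analytic0M => //; [exact: analytic0_cst|exact: analytic0_coord].
  apply: analytic0_sum => // s; apply: analytic0M => //; first exact: analytic0_coord.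
  apply: analytic0B => //; apply: analytic0_sum => // k; apply: analytic0M => //.
  - exact: (analytic0_comp Hs (defect_analytic k s) F0 F_analytic).
  - by have [] := H1 k.
  - exact: analytic0_coord.
  - by have [] := H2 (s, k).
have H1' : \forall z \near (0 : 'rV[K]_(n + m)), forall k i,
    zeta1 k i z = dmap F (xi1 k) i z + eta1 k i (F z).
  apply: near0_forall => k; apply: near0_forall => i.
  by have [_ [_]] := H1 k; apply.
have H2' : \forall z \near (0 : 'rV[K]_(n + m)), forall sr i,
    zeta2 sr i z = dmap F (xi2 sr) i z + eta2 sr i (F z).
  apply: near0_forall => sr; apply: near0_forall => i.
  by have [_ [_]] := H2 sr; apply.
move=> i; move: (near0_and euler_F HAE) (near0_and H1' H2'); apply: filterS2.
move=> z [HE {}HAE] [{}H1' {}H2'].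
pose P l := pderiv (Defs.comp F i) l z.
have dmE (u : 'I_(n + m) -> 'rV[K]_(n + m) -> K) : dmap F u i z = \sum_l u l z * P l by [].
have LamF s : Lam s (F z) = lam s z by exact: comp_F_r.
have xiE : dmap F xi i z = dmap F (fun i z => sourceWeight i * z ord0 i) i z -
    \sum_(s < m) lam s z * (\sum_(k < m) defect k s (F z) * dmap F (xi1 k) i z -
      \sum_(r < m) lam r z * dmap F (xi2 (s, r)) i z).
  rewrite !dmE; under [LHS]eq_bigr do rewrite mulrBl.
  rewrite sumrB; congr (_ - _).
  under [LHS]eq_bigr do rewrite mulr_suml; rewrite exchange_big /=; apply: eq_bigr => s _.
  under [LHS]eq_bigr do rewrite -mulrA; rewrite -mulr_sumr; congr (_ * _).
  under [LHS]eq_bigr do rewrite mulrBl.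
  rewrite sumrB; congr (_ - _).
    under [LHS]eq_bigr do rewrite mulr_suml; rewrite exchange_big /=; apply: eq_bigr => k _.
    by rewrite mulr_sumr; apply: eq_bigr => l _; rewrite mulrA.
  under [LHS]eq_bigr do rewrite mulr_suml; rewrite exchange_big /=; apply: eq_bigr => k _.
  by rewrite mulr_sumr; apply: eq_bigr => l _; rewrite mulrA.
rewrite xiE HE /eta -/(Defs.comp F i z) -addrA; congr (_ + _).
rewrite -sumrB; apply: eq_bigr => s _.
rewrite LamF -mulrBr; congr (_ * _).
(* Here the defect at [g z] is exchanged for the defect at [F z], so that its coefficients come from
   the target. *)
rewrite (eq_bigr (fun k => (defect k s (F z) -
    \sum_(r < m) lam r z * A k s r z) * zeta1 k i z)); last first.
  by move=> k _; rewrite -(HAE (k, s)).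
under eq_bigr do rewrite mulrBl.
rewrite sumrB.
have -> : \sum_(k < m) (\sum_(r < m) lam r z * A k s r z) * zeta1 k i z =
    \sum_(r < m) lam r z * zeta2 (s, r) i z.
  under [LHS]eq_bigr do rewrite mulr_suml; rewrite exchange_big /=; apply: eq_bigr => r _.
  by rewrite /zeta2 mulr_sumr; apply: eq_bigr => k _; rewrite mulrA.
rewrite /a; under [X in _ = X - _ + _]eq_bigr do rewrite H1' mulrDr.
under [X in _ = _ - X + _]eq_bigr do rewrite H2' mulrDr.
rewrite !big_split /=; under [X in _ - X = _]eq_bigr do rewrite LamF.
by ring.
Qed.

End Substantial.

(** * The real and complex cases *)

Lemma Theorem5_complete (K : numFieldType) : summationComplete K -> Theorem5 K.
Proof.
move=> Hs n p m f w d alpha jk f_analytic f0 _ _ [_ [_ hom]] good q q_analytic q0 st.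
apply: (unfolding_substantial Hs f_analytic f0 hom q_analytic q0) => // k.
(* Good weights compare natural numbers; characteristic zero turns their inequality into [e k != 0]
   in [K]. *)
by rewrite subr_eq0 eqr_nat eq_sym; apply/eqP; exact: good.
Qed.

(* K = R (the reals, R : realType) and K = C = R[i] *)
Theorem mainTheorem5 (R : realType) : Theorem5 R /\ Theorem5 (R[i])%C.
Proof.
split; apply: Theorem5_complete; first exact: summationComplete_real.
exact: summationComplete_complex.
Qed.
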